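(* Let $E,E'$ be real Banach spaces of dimension at least $2$, and let $G\subsetneq E$ and $G'\subsetneq E'$ be domains. Suppose that $G$ is $c$-uniform and that a homeomorphism $f:\overline{G}\to\overline{G'}$ is $\eta$-quasimöbius relative to $\partial G$ and maps $G$ onto $G'$. Then $G'$ is diameter $c'$-uniform with $c'=c'(c,\eta)$ depending only on $c$ and $\eta$. If in addition $G'$ is $\psi$-natural, then $G'$ is $c_1'$-uniform with $c_1'=c_1'(c,\eta,\psi)$ depending only on $c$, $\eta$ and $\psi$.
   Context: A domain is a nonempty connected open set; norms are written $|\cdot|$. For a set $A$ in a Banach space, $\overline{A}$ denotes its completion (that is, its norm closure) and $\partial A=\overline{A}\setminus A$ its norm boundary. For $x\in G$, $d_G(x)=\operatorname{dist}(x,\partial G)$. For an arc $\gamma$ and $x,z\in\gamma$, $\gamma[x,z]$ is the subarc between $x$ and $z$, and $\ell(\gamma)$ is the norm length; $\operatorname{diam}$ is the norm diameter. Relative quasimöbius maps: for a metric space $X$ write $\dot X=X\cup\{\infty\}$. The cross ratio of four distinct points is $\tau(x,y,z,w)=\frac{|x-z|}{|x-y|}\cdot\frac{|y-w|}{|z-w|}$, where $|a-b|$ denotes distance; if one of the points is $\infty$, the two distances involving it are cancelled, e.g. $\tau(x,y,z,\infty)=\frac{|x-z|}{|x-y|}$. Let $\eta:[0,\infty)\to[0,\infty)$ be a homeomorphism, $X,Y$ metric spaces, and $A\subseteq X_0\subseteq\dot X$. An embedding $f:X_0\to\dot Y$ is $\eta$-quasimöbius relative to $A$ if $\tau(f(x),f(y),f(z),f(w))\le\eta(\tau(x,y,z,w))$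 for every quadruple of distinct points $x,y,z,w\in X_0$ with $\{x,w\}\subseteq A$ or $\{y,z\}\subseteq A$. In the claim this is applied with $X_0=\overline G$ and $A=\partial G$. $c$-uniform ($c\ge1$): each pair of points $x,y\in G$ can be connected by an arc $\gamma$ in $G$ with $\ell(\gamma)\le c|x-y|$ and $\min\{\ell(\gamma[x,z]),\ell(\gamma[z,y])\}\le c\,d_G(z)$ for all $z\in\gamma$. Diameter $c$-uniform ($c\ge1$): each pair of points $x_1,x_2\in G$ can be joined by an arc $\alpha$ in $G$ with $\operatorname{diam}\alpha\le c|x_1-x_2|$ and $\min_{j=1,2}\operatorname{diam}(\alpha[x_j,x])\le c\,d_G(x)$ for all $x\in\alpha$. Quasihyperbolic metric: $k_G(x,y)=\inf\int_\alpha\frac{|dz|}{d_G(z)}$, the infimum over all rectifiable curves $\alpha$ in $G$ joining $x$ and $y$. Put $r_G(x,y)=\frac{|x-y|}{\min\{d_G(x),d_G(y)\}}$ and, for nonempty $A\subseteq G$, $r_G(A)=\sup_{x,y\in A}r_G(x,y)$, $k_G(A)=\sup_{x,y\in A}k_G(x,y)$. $\psi$-natural: for an increasing function $\psi:[0,\infty)\to[0,\infty)$, $G$ is $\psi$-natural if $k_G(A)\le\psi(r_G(A))$ for every nonempty connected $A\subseteq G$ with $r_G(A)<\infty$. (The same definitions are used for $G'$ in $E'$.) *)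

(* Defs.v *)
From HB Require Import structures.
From mathcomp Require Import all_boot all_order all_algebra.
From mathcomp Require Import all_classical all_reals all_analysis.

Set Implicit Arguments.
Unset Strict Implicit.
Unset Printing Implicit Defensive.

Import Order.TTheory GRing.Theory Num.Theory.
Import numFieldNormedType.Exports.

Local Open Scope classical_set_scope.
Local Open Scope ring_scope.

Definition homeomorphism_on (T U : topologicalType) (A : set T) (B : set U)
    (f : T -> U) : Prop :=
  [/\ set_bij A B f, {within A, continuous f} &
      exists2 g : U -> T, {in A, cancel f g} & {within B, continuous g}].

Section Domains.
Context {R : realType} {E : normedModType R}.
Implicit Types (G A : set E) (x y : E) (gam : R -> E).

Definition domain G : Prop := [/\ G !=set0, open G & connected G].

Definition bd A : set E := closure A `\` A.

Definition bd_dist G x : R := inf [set `|x - y| | y in bd G].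

Definition diameter A : \bar R :=
  ereal_sup [set `|p.1 - p.2|%:E | p in A `*` A].

(* Same partitions as in the library's [total_variation], which only covers
   real-valued functions. *)
Definition curve_length (a b : R) gam : \bar R :=
  ereal_sup [set (\sum_(0 <= n < size s)
      `|gam (nth b (a :: s) n.+1) - gam (nth b (a :: s) n)|)%:E
    | s in itv_partition a b].

Definition trace gam (a b : R) : set E := gam @` `[a, b].

Definition curve_in G x y gam : Prop :=
  [/\ {within `[0, 1], continuous gam}, gam 0 = x, gam 1 = y &
      trace gam 0 1 `<=` G].

(* An arc is represented by an injective parametrization gam on [0, 1]; its
   subarc between gam s and gam t is then the image of [s, t], so lengths and
   diameters of subarcs do not depend on the parametrization. *)
Definition arc_in G x y gam : Prop :=
  curve_in G x y gam /\ set_inj `[0, 1] gam.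

(* An arc has distinct endpoints; for x = y both conditions below are trivially
   met by the degenerate curve, so only pairs x != y are considered. *)
Definition uniform_domain (c : R) G : Prop :=
  1 <= c /\
  forall x y, G x -> G y -> x != y ->
  exists2 gam : R -> E, arc_in G x y gam &
    (curve_length 0 1 gam <= (c * `|x - y|)%:E)%E /\
    (forall t, 0 <= t <= 1 ->
      (Order.min (curve_length 0 t gam) (curve_length t 1 gam)
         <= (c * bd_dist G (gam t))%:E)%E).

Definition diameter_uniform_domain (c : R) G : Prop :=
  1 <= c /\
  forall x y, G x -> G y -> x != y ->
  exists2 gam : R -> E, arc_in G x y gam &
    (diameter (trace gam 0 1) <= (c * `|x - y|)%:E)%E /\
    (forall t, 0 <= t <= 1 ->
      (Order.min (diameter (trace gam 0 t)) (diameter (trace gam t 1))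
         <= (c * bd_dist G (gam t))%:E)%E).

Definition rectifiable gam : Prop := (curve_length 0 1 gam < +oo)%E.

(* Arc-length parametrization of a rectifiable curve: the value at s is gam t
   for any t in [0, 1] at which the length travelled is s. Such a t exists for
   s in [0, length], and gam t does not depend on its choice. *)
Definition arclength_param gam (s : R) : E :=
  gam (xget 0 [set t : R | 0 <= t <= 1 /\ curve_length 0 t gam = s%:E]).

Definition line_integral (rho : E -> R) gam : \bar R :=
  (\int[lebesgue_measure]_(s in `[0%R, fine (curve_length 0 1 gam)])
     (rho (arclength_param gam s))%:E)%E.

Definition qh_dist G x y : \bar R :=
  ereal_inf [set line_integral (fun z => (bd_dist G z)^-1) gam
            | gam in [set gam | curve_in G x y gam /\ rectifiable gam]].

Definition rel_dist G x y : R :=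
  `|x - y| / Num.min (bd_dist G x) (bd_dist G y).

Definition qh_diam G A : \bar R :=
  ereal_sup [set qh_dist G p.1 p.2 | p in A `*` A].

Definition rel_diam G A : \bar R :=
  ereal_sup [set (rel_dist G p.1 p.2)%:E | p in A `*` A].

Definition natural_domain (psi : R -> R) G : Prop :=
  forall A, A !=set0 -> connected A -> A `<=` G ->
    (rel_diam G A < +oo)%E ->
    (qh_diam G A <= (psi (fine (rel_diam G A)))%:E)%E.

End Domains.

Section Quasimoebius.
Context {R : realType}.

(* The extended space of X is [option X], with [None] as the point oo. A
   distance to oo is replaced by 1: in the cross ratio of distinct points each
   point occurs in one numerator and one denominator distance, so this cancels
   exactly the two distances involving oo. *)
Definition ext_dist (X : normedModType R) (p q : option X) : R :=
  if p is Some x then if q is Some y then `|x - y| else 1 else 1.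

Definition cross_ratio (X : normedModType R) (x y z w : option X) : R :=
  ext_dist x z / ext_dist x y * (ext_dist y w / ext_dist z w).

(* The cross-ratio condition only; that f is an embedding of X0 is to be assumed
   separately. *)
Definition quasimoebius_rel (X Y : normedModType R) (eta : R -> R)
    (X0 A : set (option X)) (f : option X -> option Y) : Prop :=
  A `<=` X0 /\
  forall x y z w, X0 x -> X0 y -> X0 z -> X0 w -> uniq [:: x; y; z; w] ->
    (A x /\ A w) \/ (A y /\ A z) ->
    cross_ratio (f x) (f y) (f z) (f w) <= eta (cross_ratio x y z w).

End Quasimoebius.

Definition dim_ge2 {R : realType} (E : normedModType R) : Prop :=
  exists u v : E, forall a b : R, a *: u + b *: v = 0 -> a = 0 /\ b = 0.

Definition increasing_nneg {R : realType} (psi : R -> R) : Prop :=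
  (forall s, 0 <= s -> 0 <= psi s) /\
  (forall s t, 0 <= s -> s <= t -> psi s <= psi t).

(* Main.v *)
(* Only quadruples containing two boundary points a, b are controlled, so all
   estimates go through the function u(p) = |a - p| / |b - p|. On a c-uniform arc
   from x to y, every point w between x and a third point z of the arc satisfies
   u(w) <= L max(u(x), u(z)) with L = L(c), and likewise between z and y. Since
   u(w) / u(p) is a cross ratio, the image path satisfies the same inequalities
   with L replaced by the supremum of eta on [0, L]. Choosing a close to a point
   of the image path and b far from a turns them into the diameter conditions,
   provided that the boundary of G' is spread out at the scale |x - y|.

   Otherwise the boundary of G' lies in a ball B(o, D) with D at most a constant
   times |x - y|. The image path is not controlled far from o, so its part between
   the first and the last visit to the sphere of radius 128 D about o is replaced
   by a polygon that stays away from o.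

   Arcs are obtained from chains of points whose consecutive distances are at
   most half the distance to the boundary, by erasing loops in the polygon.

   For a natural domain, a diameter uniform arc is cut, starting from each end x,
   at points where |. - x| doubles. Each piece has quasihyperbolic diameter at
   most psi(4c) and is replaced by a curve whose length is comparable to its
   distance from the boundary. The lengths form a geometric sum. *)

Require Import Defs.
From mathcomp Require Import all_boot all_order all_algebra.
From mathcomp Require Import all_classical all_reals all_analysis.
From mathcomp Require Import lra zify.
Import Order.TTheory GRing.Theory Num.Theory.
Import numFieldNormedType.Exports.
Local Open Scope classical_set_scope.
Local Open Scope ring_scope.

Set Implicit Arguments.
Unset Strict Implicit.
Unset Printing Implicit Defensive.

(** [f] controls no distance between interior points, so neither lengths nor diameters of the
    uniform arc can be carried over. The three-point inequality needs only boundary points as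
    references. Of a and b, the one near z makes the ratio extreme at z and thereby pulls an
    endpoint towards z; the other normalises and must therefore be far away. If the boundary lies in
    B(o, D), then u is close to 1 far from o and the inequality is void there; for a one-point
    boundary it says nothing anywhere. Out there d(z) is comparable to |z - o|, so a polygon outside
    the ball serves as well, provided that it can turn around o: in dimension 1 it could not. The
    polygon must not move inward by more than a fixed factor, so that all its earlier points stay
    within a multiple of d(z); the path is reversed if it would have to move inward. Chains let
    pieces of different origin be concatenated although they may cross. Injectivity is restored
    once, at the end; steps of half the boundary distance keep d comparable along each edge. The
    bound k >= ln(1 + length / d) converts quasihyperbolic distance into length. *)

(** * Continuity on intervals and first hitting times *)

Definition cont_on {R : realType} {V : normedModType R} (a b : R) (g : R -> V) :=
  forall t, a <= t <= b -> forall e : R, 0 < e ->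
  exists2 del : R, 0 < del &
    forall s, a <= s <= b -> `|s - t| < del -> `|g s - g t| < e.

Section ContOn.
Context {R : realType} {V : normedModType R}.
Implicit Types (g : R -> V) (a b : R).

Lemma within_cont_on a b g : {within `[a, b], continuous g} <-> cont_on a b g.
Proof.
split=> [/subspace_continuousP cg t tab e e0|cg].
  have tA : `[a, b]%classic t by rewrite /= in_itv.
  have /cvgrPdist_lt/(_ e e0) := cg t tA.
  rewrite /within /= => /nbhs_ballP[del /= del0 H]; exists del => // s sab st.
  have := H s; rewrite -ball_normE /= distrC => /(_ st).
  by rewrite in_itv /= sab distrC; apply.
apply/subspace_continuousP => t; rewrite /= in_itv /= => tab.
apply/cvgrPdist_lt => e e0; have [del del0 H] := cg t tab e e0.
rewrite /within /=; apply/nbhs_ballP; exists del => //= s.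
rewrite -ball_normE /= distrC => st; rewrite in_itv /= => sab.
by rewrite distrC; apply: H.
Qed.

Lemma cont_on_sub a b a' b' g : a <= a' -> b' <= b -> cont_on a b g -> cont_on a' b' g.
Proof.
move=> aa bb cg t /andP[at_ tb] e e0.
have [|del d0 H] := cg t _ e e0; first by apply/andP; split; lra.
by exists del => // s /andP[as_ sb]; apply: H; apply/andP; split; lra.
Qed.

Lemma lip_cont_on a b g (K : R) :
  (forall s t, a <= s -> s <= t -> t <= b -> `|g t - g s| <= K * (t - s)) ->
  cont_on a b g.
Proof.
move=> gK t /andP[at_ tb] e e0; have K0 : 0 < `|K| + 1 by rewrite ltr_pwDr.
exists (e / (`|K| + 1)); first by rewrite divr_gt0.
move=> s /andP[as_ sb]; rewrite ltr_pdivlMr// => H.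
apply: le_lt_trans H; rewrite mulrC; have KK := ler_norm K.
have [st|ts] := leP s t.
  rewrite distrC; apply: le_trans (gK _ _ as_ st tb) _.
  by rewrite (distrC s) (@ger0_norm _ (t - s)) ?subr_ge0//; nra.
apply: le_trans (gK _ _ at_ (ltW ts) sb) _.
by rewrite (@ger0_norm _ (s - t)) ?subr_ge0 ?(ltW ts)//; nra.
Qed.

Lemma cont_on_comp_lip a b a' b' g (h : R -> R) (K : R) : 0 < K ->
  (forall s, a' <= s <= b' -> a <= h s <= b) ->
  (forall s t, a' <= s <= b' -> a' <= t <= b' -> `|h s - h t| <= K * `|s - t|) ->
  cont_on a b g -> cont_on a' b' (g \o h).
Proof.
move=> K0 hab hK cg t tab e e0; have [del d0 H] := cg _ (hab _ tab) e e0.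
exists (del / K); first by rewrite divr_gt0.
move=> s sab; rewrite ltr_pdivlMr// mulrC => st.
by apply: H; [exact: hab | apply: le_lt_trans (hK _ _ sab tab) st].
Qed.

Lemma cont_on_dist a b g (o : V) : cont_on a b g -> cont_on a b (fun t => `|g t - o|).
Proof.
move=> cg t tab e e0; have [del d0 H] := cg t tab e e0.
exists del => // s sab st; apply: le_lt_trans (H s sab st).
apply: le_trans (ler_dist_dist _ _) _.
by rewrite opprB addrA subrK.
Qed.

End ContOn.

(** The maximum with [g 0] absorbs the case that [g] starts above [v], where the hitting time is 0.
    Otherwise [t] is the supremum of the times up to which [g] stays below [v]; continuity excludes
    both strict inequalities there. *)
Lemma first_hit {R : realType} (g : R -> R) (b v t0 : R) :
  cont_on 0 b g -> 0 <= t0 <= b -> v <= g t0 ->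
  exists t, [/\ 0 <= t <= t0, g t = Num.max v (g 0) &
    forall s, 0 <= s <= t -> g s <= g t].
Proof.
move=> cg /andP[t00 t0b] vg.
have [v0|v0] := leP v (g 0).
  exists 0; rewrite lexx t00; split => //.
  by move=> s s0; have -> : s = 0 by apply/eqP; rewrite eq_le andbC.
pose S := [set t : R | 0 <= t <= t0 /\ forall s, 0 <= s <= t -> g s < v].
have S0 : S 0.
  split; first by rewrite lexx.
  by move=> s s0; have -> : s = 0 by apply/eqP; rewrite eq_le andbC.
have hS : has_sup S by split; [exists 0 | exists t0 => t [/andP[]]].
have supt0 : 0 <= sup S <= t0.
  apply/andP; split; first exact: sup_upper_bound.
  by apply: ge_sup; [exists 0 | move=> t [/andP[]]].
have /andP[sup0 supt] := supt0.
have below s : 0 <= s -> s < sup S -> g s < v.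
  move=> s0 ss; have [t [/andP[tp tt] St] lt] := sup_adherent (ltac:(by rewrite subr_gt0;
    exact: ss) : 0 < sup S - s) hS.
  by apply: St; rewrite s0 /=; lra.
have supb : 0 <= sup S <= b by apply/andP; split; lra.
have gev : v <= g (sup S).
  rewrite leNgt; apply/negP => gv.
  have [lt|] := ltP (sup S) t0; last first.
    by move=> ?; have H : sup S = t0 by [apply/eqP; rewrite eq_le supt]; move: gv;
      rewrite H ltNge vg.
  have [del d0 H] := cg _ supb (v - g (sup S)) (ltac:(by rewrite subr_gt0)).
  pose t1 := Num.min t0 (sup S + del / 2).
  have t1s : sup S < t1 by rewrite lt_min lt ltrDl divr_gt0.
  have : S t1.
    split; first by rewrite ge_min lexx /= (le_trans sup0) // ltW.
    move=> s /andP[s0 st]; have [ss|ss] := ltP s (sup S); first exact: below.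
    have s1 : s <= t0 by apply: le_trans st _; rewrite ge_min lexx.
    have s2 : s <= sup S + del / 2 by apply: le_trans st _; rewrite ge_min lexx orbT.
    have := H s (ltac:(by apply/andP; split; lra)).
    rewrite ger0_norm ?subr_ge0// => /(_ (ltac:(lra))) /(le_lt_trans (ler_norm _)); lra.
  by move=> /(sup_upper_bound hS); rewrite leNgt t1s.
have gle : g (sup S) <= v.
  rewrite leNgt; apply/negP => gv.
  have [sp|] := ltP 0 (sup S); last first.
    move=> s0; have {}s0 : sup S = 0 by apply/eqP; rewrite eq_le sup0 andbT.
    by move: gv; rewrite s0 ltNge ltW.
  have [del d0 H] := cg _ supb (g (sup S) - v) (ltac:(by rewrite subr_gt0)).
  pose s := Num.max 0 (sup S - del / 2).
  have ss : s < sup S by rewrite gt_max sp ltrBlDr ltrDl divr_gt0.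
  have s0 : 0 <= s by rewrite le_max lexx.
  have s1 : sup S - del / 2 <= s by rewrite le_max lexx orbT.
  have := H s (ltac:(by apply/andP; split; lra)).
  rewrite distrC ger0_norm ?subr_ge0 ?ltW// => /(_ (ltac:(lra))).
  by rewrite distrC => /(le_lt_trans (ler_norm _)); have := below _ s0 ss; lra.
have gs : g (sup S) = v by apply/eqP; rewrite eq_le gle.
exists (sup S); rewrite gs; split => // s /andP[s0]; rewrite le_eqVlt => /predU1P[->|/below];
  first by rewrite gs.
by move=> /(_ s0)/ltW.
Qed.

(** * Domains and curve length *)

Section DomainBasics.
Context {R : realType} {E : normedModType R}.
Implicit Types (G : set E) (x y z : E).

Lemma ler_triangle x y z : `|x - y| <= `|x - z| + `|z - y|.
Proof. by apply: le_trans (ler_normD _ _); rewrite addrA subrK. Qed.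

Lemma bd_nonempty G : domain G -> G != setT -> bd G !=set0.
Proof.
move=> [G0 oG _] GT; apply: contrapT => nb.
have clG : closed G.
  rewrite closure_id; apply/seteqP; split; first exact: subset_closure.
  by move=> x cx; apply: contrapT => nx; apply: nb; exists x.
have [z Gz] := G0.
have [w nGw] : exists w, ~ G w.
  apply: contrapT => H; move/eqP: GT; apply; apply/seteqP; split=> // w _.
  by apply: contrapT => nw; apply: H; exists w.
pose h (t : R) := z + t *: (w - z).
have ch : continuous h.
  by move=> t; apply: cvgD; [exact: cvg_cst|apply: cvgZl; exact: cvg_id].
have H : connected (h @` `[0, 1]).
  apply: connected_continuous_connected; first exact: segment_connected.
  exact: continuous_subspaceT.
have h0 : h 0 = z by rewrite /h scale0r addr0.
have h1 : h 1 = w by rewrite /h scale1r addrC subrK.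
have := H (h @` `[0, 1] `&` G) _ _ _.
move=> /(_ _ _ _)/seteqP[|||_ sub].
- by exists z; split => //; exists 0 => //=; rewrite in_itv /= lexx ler01.
- by exists G.
- by exists G.
- by have [] : (h @` `[0, 1] `&` G) w by apply: sub; exists 1 => //=;
  rewrite in_itv /= lexx ler01.
Qed.

Lemma bd_dist_lb G x : lbound [set `|x - y| | y in bd G] 0.
Proof. by move=> _ [y _ <-]. Qed.

Lemma bd_dist_le G x y : bd G y -> bd_dist G x <= `|x - y|.
Proof. by move=> Gy; apply: ge_inf; [exists 0; exact: bd_dist_lb|exists y]. Qed.

Lemma bd_dist_ge G x (r : R) : bd G !=set0 ->
  (forall y, bd G y -> r <= `|x - y|) -> r <= bd_dist G x.
Proof.
move=> [b Gb] H; apply: lb_le_inf; first by exists `|x - b|, b.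
by move=> _ [y Gy <-]; exact: H.
Qed.

Lemma bd_dist_ge0 G x : 0 <= bd_dist G x.
Proof.
rewrite /bd_dist; have [[b Gb]|H] := pselect (bd G !=set0).
  by apply: bd_dist_ge => //; exists b.
(* The infimum of the empty set is 0 by convention. *)
suff -> : [set `|x - y| | y in bd G] = set0 by rewrite inf0.
by apply/seteqP; split=> // r [y Gy _]; exfalso; apply: H; exists y.
Qed.

Lemma bd_dist_lip G x y : bd G !=set0 -> bd_dist G x <= bd_dist G y + `|x - y|.
Proof.
move=> Gb; rewrite -lerBlDr; apply: bd_dist_ge => // b bb.
rewrite lerBlDr; apply: le_trans (bd_dist_le x bb) _.
by rewrite [leRHS]addrC; exact: ler_triangle.
Qed.

Lemma bd_dist_near G x : bd G !=set0 -> 0 < bd_dist G x ->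
  exists2 b, bd G b & `|x - b| <= 2 * bd_dist G x.
Proof.
move=> Gb d0; apply: contrapT => H.
have : 2 * bd_dist G x <= bd_dist G x.
  apply: bd_dist_ge => // y Gy; rewrite leNgt; apply/negP => lt.
  by apply: H; exists y => //; exact: ltW.
lra.
Qed.

Lemma bd_dist_gt0 G x : open G -> bd G !=set0 -> G x -> 0 < bd_dist G x.
Proof.
move=> oG Gb Gx.
have /nbhs_ballP[e /= e0 sub] : nbhs x G by exact: open_nbhs_nbhs.
apply: lt_le_trans e0 _; apply: bd_dist_ge => // y [_ nGy].
rewrite leNgt; apply/negP => lt; apply: nGy; apply: sub.
by rewrite -ball_normE.
Qed.

(** On a segment that avoids [bd G], the sets [G] and [closure G] have the same trace. It is open
    and closed in the segment, hence all of it. *)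
Lemma segment_in G x p : open G -> G x ->
  (forall t : R, 0 <= t <= 1 -> ~ bd G (x + t *: (p - x))) ->
  forall t : R, 0 <= t <= 1 -> G (x + t *: (p - x)).
Proof.
move=> oG Gx avoid t t01.
pose h (t : R) := x + t *: (p - x).
have ch : continuous h.
  by move=> s; apply: cvgD; [exact: cvg_cst|apply: cvgZl; exact: cvg_id].
have H : connected (h @` `[0, 1]).
  apply: connected_continuous_connected; first exact: segment_connected.
  exact: continuous_subspaceT.
have := H (h @` `[0, 1] `&` G) _ _ _.
move=> /(_ _ _ _)/seteqP[|||_ sub].
- exists x; split => //; exists 0; first by rewrite /= in_itv /= lexx ler01.
  by rewrite /h scale0r addr0.
- by exists G.
- exists (closure G); first exact: closed_closure.
  apply/seteqP; split=> z [hz Gz]; split => //; first exact: subset_closure.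
  apply: contrapT => nG; case: hz => s; rewrite /= in_itv /= => s01 hs.
  by apply: (avoid s s01); rewrite -/(h s) hs.
- have [] // : (h @` `[0, 1] `&` G) (h t).
  by apply: sub; exists t; rewrite //= in_itv.
Qed.

Lemma seg_dist x p (s t : R) :
  `|(x + s *: (p - x)) - (x + t *: (p - x))| = `|s - t| * `|p - x|.
Proof. by rewrite opprD addrACA subrr add0r -scalerBl normrZ. Qed.

Lemma ball_in G x p : open G -> bd G !=set0 -> G x -> `|p - x| < bd_dist G x -> G p.
Proof.
move=> oG Gb Gx lt.
have := @segment_in G x p oG Gx _ 1; rewrite scale1r [x + _]addrC subrK; apply;
  last by rewrite lexx ler01.
move=> t /andP[t0 t1] bt; have := bd_dist_le x bt.
rewrite leNgt => /negP; apply.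
rewrite opprD addrA subrr add0r normrN normrZ ger0_norm//.
by apply: le_lt_trans lt; rewrite ler_piMl.
Qed.

End DomainBasics.

Section Curves.
Context {R : realType} {E : normedModType R}.
Implicit Types (g : R -> E) (a b : R) (x : E).

Fixpoint plen x (s : seq E) : R := if s is y :: s' then `|y - x| + plen y s' else 0.

Lemma plen_cat x s1 s2 : plen x (s1 ++ s2) = plen x s1 + plen (last x s1) s2.
Proof. by elim: s1 x => [x|y s IH x] /=; rewrite ?add0r// IH addrA. Qed.

Lemma plen_partition a b g s :
  \sum_(0 <= n < size s) `|g (nth b (a :: s) n.+1) - g (nth b (a :: s) n)|
  = plen (g a) (map g s).
Proof.
elim: s a => [a|h t IH a]; first by rewrite big_nil.
by rewrite /= big_nat_recl//= -IH.
Qed.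

Lemma plen_le_curve_length a b g s : path <%R a s -> last a s = b ->
  ((plen (g a) (map g s))%:E <= curve_length a b g)%E.
Proof.
move=> ps ls; apply: ereal_sup_ubound; exists s; last by rewrite plen_partition.
by split => //; rewrite ls.
Qed.

Lemma curve_length_le a b g (M : R) :
  (forall s, path <%R a s -> last a s = b -> plen (g a) (map g s) <= M) ->
  (curve_length a b g <= M%:E)%E.
Proof.
move=> H; apply: ge_ereal_sup => _ [s [ps /eqP ls] <-].
by rewrite plen_partition lee_fin; apply: H.
Qed.

Lemma curve_length_ge_dist a b g : a <= b -> (`|g b - g a|%:E <= curve_length a b g)%E.
Proof.
rewrite le_eqVlt => /predU1P[<-|ab].
  by rewrite subrr normr0; have := @plen_le_curve_length a a g [::]; apply.
have := @plen_le_curve_length a b g [:: b]; rewrite /= ab addr0; exact.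
Qed.

Lemma curve_length_ge0 a b g : a <= b -> (0 <= curve_length a b g)%E.
Proof. by move=> ab; apply: le_trans (curve_length_ge_dist g ab). Qed.

Lemma plen_map_lip a b g (K : R) :
  (forall s t, a <= s -> s <= t -> t <= b -> `|g t - g s| <= K * (t - s)) ->
  forall l c, path <%R c l -> a <= c -> last c l <= b ->
  plen (g c) (map g l) <= K * (last c l - c).
Proof.
move=> gK; elim=> [c|h t IH c] /=; first by rewrite subrr mulr0.
move=> /andP[ch pt] ac lb.
have hl : h <= last h t.
  have := mem_last h t; rewrite inE => /predU1P[->//|].
  by move/(order_path_min lt_trans)/allP: pt => /[apply]/ltW.
have H1 := IH h pt (le_trans ac (ltW ch)) lb.
have H2 := gK _ _ ac (ltW ch) (le_trans hl lb).
by lra.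
Qed.

Lemma curve_length_lip a b g (K : R) :
  (forall s t, a <= s -> s <= t -> t <= b -> `|g t - g s| <= K * (t - s)) ->
  (curve_length a b g <= (K * (b - a))%:E)%E.
Proof.
move=> gK; apply: curve_length_le => s ps ls.
by rewrite -ls; apply: (@plen_map_lip a b) => //; rewrite ls.
Qed.

Lemma curve_length_superadd a b c g : a <= c -> c <= b ->
  (curve_length a c g + curve_length c b g <= curve_length a b g)%E.
Proof.
move=> ac cb.
have [->|fin] := eqVneq (curve_length a b g) +oo%E; first by rewrite leey.
have key s t : path <%R a s -> last a s = c -> path <%R c t -> last c t = b ->
    ((plen (g a) (map g s) + plen (g c) (map g t))%:E <= curve_length a b g)%E.
  move=> ps ls pt lt; have := @plen_le_curve_length a b g (s ++ t).
  by rewrite cat_path ps ls pt last_cat ls map_cat plen_cat last_map ls; apply.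
have [L HL] : exists L : R, curve_length a b g = L%:E.
  case E1 : (curve_length a b g) fin => [L||] //; first by exists L.
  by have := curve_length_ge0 g (le_trans ac cb); rewrite E1.
rewrite HL in key *.
(* The supremum over pairs of partitions is taken one variable at a time: first over the partitions
   of [a, c] with [t] fixed, then over [t]. *)
have H1 t : path <%R c t -> last c t = b ->
    (curve_length a c g <= (L - plen (g c) (map g t))%:E)%E.
  move=> pt lt; apply: curve_length_le => s ps ls.
  by rewrite lerBrDr -lee_fin; apply: key.
have [s0 ps0 ls0] : exists2 t, path <%R c t & last c t = b.
  move: cb; rewrite le_eqVlt => /predU1P[<-|cb]; first by exists [::].
  by exists [:: b]; rewrite //= cb.
have [A HA] : exists A : R, curve_length a c g = A%:E.
  case E1 : (curve_length a c g) (H1 _ ps0 ls0) (curve_length_ge0 g ac) => [A||] //.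
  by exists A.
rewrite HA -leeBrDl// -EFinB; apply: curve_length_le => t pt lt.
by have := H1 t pt lt; rewrite HA lee_fin; lra.
Qed.

Lemma curve_length_sub a b s t g : a <= s -> s <= t -> t <= b ->
  (`|g t - g s|%:E <= curve_length a b g)%E.
Proof.
move=> as_ st tb.
apply: le_trans (curve_length_ge_dist g st) _.
apply: le_trans (curve_length_superadd g (le_trans as_ st) tb).
apply: le_trans (leeDl _ (curve_length_ge0 g tb)).
apply: le_trans (curve_length_superadd g as_ st).
by apply: leeDr; exact: curve_length_ge0.
Qed.

Lemma partition_split a b c g s : a <= c -> c <= b -> path <%R a s -> last a s = b ->
  exists s1 s2, [/\ path <%R a s1, last a s1 = c, path <%R c s2, last c s2 = b &
    plen (g a) (map g s) <= plen (g a) (map g s1) + plen (g c) (map g s2)].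
Proof.
elim: s a => [a ac cb _ /= ab|h t IH a ac cb /= /andP[ah pt] lt].
  have ca : c = a by apply/eqP; rewrite eq_le ac ab cb.
  by exists [::], [::]; rewrite /= ca addr0.
move: ac; rewrite le_eqVlt => /predU1P[<-|ac].
  by exists [::], (h :: t); rewrite /= ah pt add0r.
have [ch|hc|ch] := ltgtP c h.
- exists [:: c], (h :: t); rewrite /= ac ch pt addr0; split => //.
  by rewrite addrA lerD2r [leRHS]addrC; exact: ler_triangle.
- have [s1 [s2 [p1 l1 p2 l2 H]]] := IH h (ltW hc) cb pt lt.
  by exists (h :: s1), s2; rewrite /= ah p1; split => //; rewrite -addrA lerD2l.
- by exists [:: h], t; rewrite /= ah ch pt addr0; split => //; rewrite -ch.
Qed.

Lemma curve_length_subadd a b c g : a <= c -> c <= b ->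
  (curve_length a b g <= curve_length a c g + curve_length c b g)%E.
Proof.
move=> ac cb; apply: ge_ereal_sup => _ [s [ps /eqP ls] <-].
rewrite plen_partition; have [s1 [s2 [p1 l1 p2 l2 H]]] := partition_split g ac cb ps ls.
apply: (@le_trans _ _ ((plen (g a) (map g s1))%:E + (plen (g c) (map g s2))%:E)%E).
  by rewrite -EFinD lee_fin.
by apply: leeD; exact: plen_le_curve_length.
Qed.

End Curves.

(** * From chains to arcs *)

Section ArcOfChain.
Context {R : realType} {E : normedModType R}.
Implicit Types (v : nat -> E).

Definition chain_len v k : R := \sum_(i < k) `|v i.+1 - v i|.

Lemma chain_lenS v k : chain_len v k.+1 = chain_len v k + `|v k.+1 - v k|.
Proof. by rewrite /chain_len big_ord_recr. Qed.

(** The parameters at which the segment meets the trace form a compact set, and 0 is one of them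
    because [g T = p]. Its maximum is [lam]. *)
Lemma last_on_trace (g : R -> E) (T : R) (p w : E) : 0 <= T -> cont_on 0 T g -> g T = p ->
  exists lam t : R, [/\ 0 <= lam <= 1, 0 <= t <= T, g t = p + lam *: (w - p) &
    forall lam' t', lam < lam' <= 1 -> 0 <= t' <= T -> g t' <> p + lam' *: (w - p)].
Proof.
move=> T0 cg gT; pose h (t : R) := p + t *: (w - p).
have ch : continuous h.
  by move=> s; apply: cvgD; [exact: cvg_cst|apply: cvgZl; exact: cvg_id].
pose A := `[0, 1]%classic `&` h @^-1` (g @` `[0, T]%classic).
have cK : closed (g @` `[0, T]%classic).
  apply: compact_closed; first exact: norm_hausdorff.
  by apply: continuous_compact; [exact/within_cont_on|exact: segment_compact].
have cA : compact A.
  apply: (subclosed_compact _ (@segment_compact _ 0 1)); last by move=> ? [].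
  apply: closedI; first exact: interval_closed.
  by apply: closed_comp => // ? _; exact: ch.
have A0 : A !=set0.
  exists 0; split; first by rewrite /= in_itv /= lexx ler01.
  by exists T; rewrite /= ?in_itv /= ?T0 ?lexx// /h scale0r addr0.
have [lam] := @compact_EVT_max _ R id A A0 cA (continuous_subspaceT (fun x => cvg_id)).
rewrite inE => -[]; rewrite /= in_itv /= => l01 [t]; rewrite /= in_itv /= => tT gt mx.
exists lam, t; split => // lam' t' /andP[ll l1] t'T gt'.
have : lam' \in A.
  rewrite inE; split; first by rewrite /= in_itv /= l1 andbT; case/andP: l01; lra.
  by exists t'; rewrite //= in_itv.
by move/mx; rewrite leNgt ll.
Qed.

(* [idx t] is the index of an edge of the polygon containing [gam t]. Loops are
   erased edge by edge: the arc built so far is cut at the last point of the new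
   edge that lies on it. *)
Lemma arc_of_chain v n : exists (T : R) (gam : R -> E) (idx : R -> nat),
  [/\ 0 <= T, gam 0 = v 0%N, gam T = v n,
      (forall s t, 0 <= s -> s <= t -> t <= T -> `|gam t - gam s| <= 1 * (t - s)) &
   [/\ (forall s t, 0 <= s <= T -> 0 <= t <= T -> gam s = gam t -> s = t),
      (forall s t, 0 <= s -> s <= t -> t <= T -> (idx s <= idx t)%N) &
      (forall t, 0 <= t <= T -> [/\ (idx t <= n)%N,
         exists2 lam : R, 0 <= lam <= 1 &
           gam t = v (idx t) + lam *: (v (idx t).+1 - v (idx t)),
         t <= chain_len v (idx t).+1 &
         T - t <= chain_len v n - chain_len v (idx t)])]].
Proof.
elim: n => [|n [T [gam [idx [T0 g0 gT glip [ginj imono igood]]]]]].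
  exists 0, (fun=> v 0%N), (fun=> 0%N); split => //.
    by move=> s t s0 st t0; rewrite subrr normr0; lra.
  split => //.
    by move=> s t; rewrite -!eq_le => /eqP <- /eqP <-.
  move=> t; rewrite -eq_le => /eqP <-; rewrite !subrr; split => //.
  - by exists 0; rewrite ?lexx ?ler01// scale0r addr0.
  - by rewrite sumr_ge0.
have cg : cont_on 0 T gam := lip_cont_on glip.
have [lam [tau [/andP[l0 l1] /andP[tau0 tauT] gtau gnot]]] := last_on_trace (v n.+1) T0 cg gT.
set p := v n in gT gtau gnot *; set w := v n.+1 in gtau gnot *.
pose q := p + lam *: (w - p).
pose m := `|w - q|.
have wq : w - q = (1 - lam) *: (w - p).
  by rewrite /q scalerBl scale1r opprD addrA.
have mE : m = (1 - lam) * `|w - p| by rewrite /m wq normrZ ger0_norm// subr_ge0.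
have m0 : 0 <= m by rewrite /m.
(* Parametrises the rest of the edge, from [q] to [w], by arc length: [mu] runs from [lam] to 1
   while [t] covers the length [m]. *)
pose mu (t : R) := lam + (1 - lam) * ((t - tau) / m).
pose g' t := if t <= tau then gam t else p + mu t *: (w - p).
pose i' t := if t <= tau then idx t else n.
have mle : m <= `|w - p| by rewrite mE ler_piMl//; lra.
(* [t > tau] within the new domain forces [m > 0] *)
have mu01 t : tau < t -> t <= tau + m ->
  [/\ 0 < m, lam < mu t, mu t <= 1 & (mu t - lam) * `|w - p| = t - tau].
  move=> tt tm; have mp : 0 < m by lra.
  have lam1 : 0 < 1 - lam.
    by rewrite lt_neqAle subr_ge0 l1 andbT eq_sym; apply: contraTneq mp => e;
      rewrite mE e mul0r ltxx.
  have f0 : 0 < (t - tau) / m by rewrite divr_gt0 ?subr_gt0.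
  have f1 : (t - tau) / m <= 1 by rewrite ler_pdivrMr// mul1r; lra.
  split => //; rewrite /mu; [nra|nra|].
  rewrite addrC addKr mulrAC -mE mulrC divfK//; exact: lt0r_neq0.
have Sm : chain_len v n.+1 = chain_len v n + `|w - p| by rewrite chain_lenS.
have TS : T <= chain_len v n.
  have := igood 0 (ltac:(by rewrite lexx T0)) => -[_ _ _].
  have : 0 <= chain_len v (idx 0) by rewrite sumr_ge0.
  lra.
exists (tau + m), g', i'; rewrite /g' /i'; split.
- exact: addr_ge0.
- by rewrite tau0.
- case: ifPn => [tm|]; last first.
    rewrite -ltNge => lt; have [mp _ _ _] := mu01 _ lt (lexx _).
    by rewrite /mu [tau + m]addrC addrK divff ?lt0r_neq0// mulr1 subrKC scale1r subrKC.
  have m00 : m = 0 by lra.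
  rewrite m00 addr0 gtau -/q; apply/eqP; rewrite eq_sym -subr_eq0 -normr_eq0; exact/eqP.
- move=> s t s0 st tT; case: ifPn => [tt|].
    rewrite (le_trans st tt); apply: glip => //; lra.
  rewrite -ltNge => lt; have [mp mt mt1 mtE] := mu01 t lt tT.
  case: ifPn => [ss|].
    apply: (le_trans (ler_triangle _ _ q)).
    have H1 : `|p + mu t *: (w - p) - q| = t - tau.
      by rewrite seg_dist ger0_norm ?subr_ge0 ?ltW.
    have H2 : `|q - gam s| <= 1 * (tau - s) by rewrite /q -gtau; apply: glip.
    by lra.
  rewrite -ltNge => ls; have [_ ms ms1 msE] := mu01 s ls (le_trans st tT).
  have H : (mu t - mu s) * `|w - p| = t - s by lra.
  have wp0 : 0 < `|w - p| by lra.
  rewrite seg_dist ger0_norm ?H; first by lra.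
  rewrite subr_ge0 leNgt; apply/negP => lt1; nra.
- split.
  + have cross s t : 0 <= s -> s <= tau -> tau < t -> t <= tau + m ->
        gam s = p + mu t *: (w - p) -> False.
      move=> s0 ss tt tm e; have [_ lm m1 _] := mu01 t tt tm.
      by apply: (gnot (mu t) s) => //; apply/andP; split=> //; lra.
    move=> s t /andP[s0 sT] /andP[t0 tT]; case: ifPn => ss; case: ifPn => tt.
    * by apply: ginj; apply/andP; split=> //; lra.
    * by rewrite -ltNge in tt => /(cross s t s0 ss tt tT).
    * by rewrite -ltNge in ss => /esym/(cross t s t0 tt ss sT).
    * rewrite -!ltNge in ss tt; have [mp ms ms1 msE] := mu01 s ss sT.
      have [_ mt mt1 mtE] := mu01 t tt tT.
      move=> /addrI/eqP; rewrite -subr_eq0 -scalerBl -normr_eq0 normrZ mulf_eq0.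
      have wp0 : 0 < `|w - p| by lra.
      rewrite (gt_eqF wp0) orbF normr_eq0 subr_eq0 => /eqP e.
      by rewrite e in msE; lra.
  + move=> s t s0 st tT; case: (leP t tau) => [tt|lt].
      by rewrite (le_trans st tt); apply: imono => //; lra.
    case: ifPn => // ss.
    by have [] := igood s (ltac:(by apply/andP; split; lra)).
  + move=> t /andP[t0 tT]; case: ifPn => [tt|].
      have [it [l l01 gt] H1 H2] := igood t (ltac:(by apply/andP; split; lra)).
      split => //; [exact: leq_trans it _|by exists l|rewrite Sm; lra].
    rewrite -ltNge => lt; have [mp mt mt1 mtE] := mu01 t lt tT.
    have : 0 <= lam * `|w - p| by rewrite mulr_ge0.
    have : mu t * `|w - p| <= `|w - p| by rewrite ler_piMl.
    split => //; first by exists (mu t) => //; apply/andP; split => //; lra.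
      by rewrite Sm; lra.
    by rewrite Sm; lra.
Qed.

End ArcOfChain.

Section ChainToArc.
Context {R : realType} {E : normedModType R}.
Implicit Types (G : set E) (x y : E) (v : nat -> E).

Definition step G x y : bool :=
  (2 * `|x - y| <= bd_dist G x) && (2 * `|x - y| <= bd_dist G y).

Lemma stepC G x y : step G x y = step G y x.
Proof. by rewrite /step distrC andbC. Qed.

Definition is_chain G n v x y :=
  [/\ v 0%N = x, v n = y & forall i, (i < n)%N -> step G (v i) (v i.+1)].

Lemma step_in G x y : open G -> bd G !=set0 -> G x -> step G x y -> G y.
Proof.
move=> oG Gb Gx /andP[H _]; apply: (ball_in oG Gb Gx).
have := bd_dist_gt0 oG Gb Gx; rewrite distrC.
have := normr_ge0 (x - y); lra.
Qed.

Lemma chain_in G n v x y : open G -> bd G !=set0 -> G x -> is_chain G n v x y ->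
  forall i, (i <= n)%N -> G (v i).
Proof.
move=> oG Gb Gx [v0 vn st]; elim=> [|i IH] ilt; first by rewrite v0.
exact: step_in oG Gb (IH (ltnW ilt)) (st i ilt).
Qed.

(** A step is at most half the boundary distance, so a point of the edge at u stays in [G] and has
    boundary distance at least d(u) / 2. This lets conditions at vertices pass to the whole arc. The
    last two bounds hold because erasing loops only shortens the polygon. *)
Lemma chain_arc G n v x y : open G -> bd G !=set0 -> G x -> x != y ->
  is_chain G n v x y ->
  exists (T : R) (gam : R -> E) (idx : R -> nat),
  [/\ arc_in G x y gam, 0 <= T, T <= chain_len v n,
      (forall s t, 0 <= s -> s <= t -> t <= 1 -> `|gam t - gam s| <= T * (t - s)) &
   (forall s t, 0 <= s -> s <= t -> t <= 1 -> (idx s <= idx t)%N) /\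
   forall t, 0 <= t <= 1 -> let u := v (idx t) in
     [/\ (idx t <= n)%N /\ (exists2 j, (j <= n)%N & `|gam t - u| <= `|v j - u|),
         2 * `|gam t - u| <= bd_dist G u,
         bd_dist G u <= 2 * bd_dist G (gam t),
         2 * (T * t) <= 2 * chain_len v (idx t) + bd_dist G u &
         T * (1 - t) <= chain_len v n - chain_len v (idx t)]].
Proof.
move=> oG Gb Gx xy ch; have [v0 vn st] := ch.
(* Clamping makes the edge of index [n], which [arc_of_chain] admits, degenerate; otherwise it would
   lead to the arbitrary point [v n.+1]. *)
pose v' i := v (minn i n).
have v'E i : (i <= n)%N -> v' i = v i by move=> ilt; rewrite /v' (minn_idPl _).
have len i : (i <= n)%N -> chain_len v' i = chain_len v i.
  move=> ilt; apply: eq_bigr => k _; have kn : (k.+1 <= n)%N := leq_trans (ltn_ord k) ilt.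
  by rewrite !v'E// ltnW.
have [T [gam [idx [T0 g0 gT glip [ginj imono igood]]]]] := arc_of_chain v' n.
have Tp : 0 < T.
  rewrite lt_neqAle T0 andbT; apply: contraNneq xy => TT.
  by rewrite -v0 -vn -(v'E 0%N)// -(v'E n)// -g0 -gT -TT.
have T01 t : 0 <= t <= 1 -> 0 <= T * t <= T.
  by move=> /andP[t0 t1]; rewrite mulr_ge0//= ler_piMr.
have lip s t : 0 <= s -> s <= t -> t <= 1 -> `|gam (T * t) - gam (T * s)| <= T * (t - s).
  move=> s0 st' t1; apply: (le_trans (glip _ _ _ _ _)).
  - exact: mulr_ge0.
  - by rewrite ler_pM2l.
  - by rewrite ler_piMr.
  - by rewrite mul1r mulrBr.
have main t : 0 <= t <= 1 -> let u := v (idx (T * t)) in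
     [/\ (idx (T * t)%R <= n)%N /\ (exists2 j, (j <= n)%N & `|gam (T * t) - u| <= `|v j - u|),
         2 * `|gam (T * t) - u| <= bd_dist G u,
         bd_dist G u <= 2 * bd_dist G (gam (T * t)),
         2 * (T * t) <= 2 * chain_len v (idx (T * t)) + bd_dist G u &
         T * (1 - t) <= chain_len v n - chain_len v (idx (T * t))].
  move=> t01 u; have [it [l /andP[l0 l1] gt] H1 H2] := igood _ (T01 t t01).
  rewrite -/u; move: H1 H2 gt; rewrite chain_lenS !len// (v'E _ it) -/u => H1 H2 gt.
  have stu : 2 * `|v' (idx (T * t)).+1 - u| <= bd_dist G u.
    have [ilt|ige] := ltnP (idx (T * t)) n.
      by have := st _ ilt; rewrite v'E// distrC => /andP[].
    have -> : v' (idx (T * t)).+1 = u.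
      by rewrite /v' /u (minn_idPr (leqW ige)); congr v; apply/eqP; rewrite eqn_leq ige it.
    by rewrite subrr normr0 mulr0 bd_dist_ge0.
  have gu : `|gam (T * t) - u| <= `|v' (idx (T * t)).+1 - u|.
    by rewrite gt addrC addKr normrZ ger0_norm// ler_piMl.
  have dg : 2 * `|gam (T * t) - u| <= bd_dist G u by lra.
  split => //; last by lra.
    by split => //; exists (minn (idx (T * t)).+1 n) => //; exact: geq_minr.
    have := bd_dist_lip u (gam (T * t)) Gb; rewrite distrC; lra.
  by lra.
exists T, (fun t => gam (T * t)), (fun t => idx (T * t)); split => //.
- split; first split.
  + by apply/within_cont_on; exact: lip_cont_on lip.
  + by rewrite mulr0 g0 v'E.
  + by rewrite mulr1 gT v'E.
  + move=> _ [t + <-]; rewrite /= in_itv /= => t01; have [[it _] H1 _ _ _] := main t t01.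
    have Gu := chain_in oG Gb Gx ch it.
    apply: (ball_in oG Gb Gu); have := bd_dist_gt0 oG Gb Gu.
    have := normr_ge0 (gam (T * t) - v (idx (T * t))); lra.
  + move=> s t; rewrite !inE /= !in_itv /= => s01 t01 /(ginj _ _ (T01 s s01) (T01 t t01)).
    by apply: mulfI; exact: lt0r_neq0.
- have := igood 0 (ltac:(by rewrite lexx T0)) => -[it _ _]; rewrite !len// => H.
  have : 0 <= chain_len v (idx 0) by rewrite sumr_ge0.
  by lra.
- split=> // s t s0 st' t1; apply: imono.
  + exact: mulr_ge0.
  + by rewrite ler_pM2l.
  + by rewrite ler_piMr.
Qed.

Lemma diameter_le (A : set E) o (M : R) : (forall z, A z -> `|z - o| <= M) ->
  (diameter A <= (2 * M)%:E)%E.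
Proof.
move=> AM; apply: ge_ereal_sup => _ [[p q] /= [Ap Aq] <-]; rewrite lee_fin.
apply: le_trans (ler_triangle _ _ o) _; rewrite (distrC o q).
by have := AM _ Ap; have := AM _ Aq; lra.
Qed.

(* Discrete form of the diameter condition: [M] bounds the whole chain, [c] its
   parts. *)
Definition dchain G (M c : R) x y := exists n v, [/\ is_chain G n v x y,
  forall i, (i <= n)%N -> `|v i - x| <= M * `|x - y| &
  forall i, (i <= n)%N ->
    (forall j, (j <= i)%N -> `|v j - x| <= c * bd_dist G (v i)) \/
    (forall j, (i <= j <= n)%N -> `|v j - y| <= c * bd_dist G (v i))].

(** The factor 10 is 2, from radius to diameter, times 5. With u the vertex belonging to [gam t], a
    vertex within c d(u) of the endpoint has boundary distance at most 3c d(u), so points of its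
    edge are within (5/2)c d(u) of the endpoint, and d(u) is at most 2 d(gam t). *)
Lemma diameter_uniform_of_dchain G c : open G -> bd G !=set0 -> 1 <= c ->
  (forall x y, G x -> G y -> x != y -> dchain G c c x y) ->
  diameter_uniform_domain (10 * c) G.
Proof.
move=> oG Gb c1 H; split; first by lra.
move=> x y Gx Gy xy; have [n [v [ch tot loc]]] := H x y Gx Gy xy.
have [T [gam [idx [arc T0 TS _ [imono main]]]]] := chain_arc oG Gb Gx xy ch.
exists gam => //; split.
  suff : (diameter (trace gam 0 1) <= (2 * (5 * c * `|x - y|))%:E)%E.
    by congr (_ <= _%:E)%E; lra.
  apply: (@diameter_le _ x) => _ [t + <-]; rewrite /= in_itv /= => t01.
  have [[it [j jn H1]] _ _ _ _] := main t t01.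
  have := ler_triangle (gam t) x (v (idx t)); have := ler_triangle (v j) (v (idx t)) x.
  rewrite (distrC x); have := tot _ it; have := tot _ jn.
  have : 0 <= c * `|x - y| by rewrite mulr_ge0//; lra.
  lra.
move=> t t01; have [[it _] H1 H2 _ _] := main t t01.
set u := v (idx t) in H1 H2.
have u0 : 0 <= bd_dist G u := bd_dist_ge0 _ _.
have step_u j : (j <= n)%N -> forall o, `|v j - o| <= c * bd_dist G u ->
  `|u - o| <= c * bd_dist G u ->
    forall s, 0 <= s <= 1 -> idx s = j -> `|gam s - o| <= 5 * c * bd_dist G (gam t).
  move=> jn o Hj Hu s s01 js; have [_ Hs _ _ _] := main s s01; rewrite js in Hs.
  have := bd_dist_lip (v j) u Gb; have := ler_triangle (v j) u o; rewrite (distrC o u).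
  have := ler_triangle (gam s) o (v j).
  have : bd_dist G u <= c * bd_dist G u by rewrite ler_peMl.
  have : c * bd_dist G u <= c * (2 * bd_dist G (gam t)) by rewrite ler_pM2l//; lra.
  lra.
have [L|L] := loc _ it; rewrite ge_min.
  apply/orP; left.
  suff : (diameter (trace gam 0 t) <= (2 * (5 * c * bd_dist G (gam t)))%:E)%E.
    by congr (_ <= _%:E)%E; lra.
  apply: (@diameter_le _ x) => _ [s + <-]; rewrite /= in_itv /= => /andP[s0 st].
  have ij : (idx s <= idx t)%N by apply: imono => //; case/andP: t01.
  apply: (step_u (idx s)) => //; first exact: leq_trans it.
  - exact: L.
  - exact: L.
  - by rewrite s0 /=; case/andP: t01 => _; exact: le_trans.
apply/orP; right.
suff : (diameter (trace gam t 1) <= (2 * (5 * c * bd_dist G (gam t)))%:E)%E.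
  by congr (_ <= _%:E)%E; lra.
apply: (@diameter_le _ y) => _ [s + <-]; rewrite /= in_itv /= => /andP[st s1].
have s01 : 0 <= s <= 1 by rewrite s1 andbT; case/andP: t01 => + _; move=> /le_trans; apply.
have [[is_ _] _ _ _ _] := main s s01.
have ij : (idx t <= idx s)%N by apply: imono => //; case/andP: t01.
apply: (step_u (idx s)) => //; first by apply: L; rewrite ij.
by apply: L; rewrite leqnn.
Qed.

Definition lchain G (c : R) x y := exists n v, [/\ is_chain G n v x y,
  chain_len v n <= c * `|x - y| &
  forall i, (i <= n)%N -> chain_len v i <= c * bd_dist G (v i) \/
     chain_len v n - chain_len v i <= c * bd_dist G (v i)].

Lemma uniform_of_lchain G c : open G -> bd G !=set0 -> 1 <= c ->
  (forall x y, G x -> G y -> x != y -> lchain G c x y) ->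
  uniform_domain (3 * c) G.
Proof.
move=> oG Gb c1 H; split; first by lra.
move=> x y Gx Gy xy; have [n [v [ch tot loc]]] := H x y Gx Gy xy.
have [T [gam [idx [arc T0 TS lip [imono main]]]]] := chain_arc oG Gb Gx xy ch.
exists gam => //; split.
  apply: le_trans (curve_length_lip lip) _; rewrite lee_fin.
  have : 0 <= c * `|x - y| by rewrite mulr_ge0//; lra.
  lra.
move=> t t01; have [[it _] H1 H2 H3 H4] := main t t01.
have /andP[t0 t1] := t01.
set u := v (idx t) in H1 H2 H3.
have u0 : 0 <= bd_dist G u := bd_dist_ge0 _ _.
have cu : bd_dist G u <= c * bd_dist G u by rewrite ler_peMl.
have cu2 : c * bd_dist G u <= c * (2 * bd_dist G (gam t)) by rewrite ler_pM2l//; lra.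
have [L|L] := loc _ it; rewrite ge_min; apply/orP; [left|right].
  apply: (le_trans (curve_length_lip (K := T) _)).
    by move=> a b a0 ab bt; apply: lip => //; apply: le_trans t1.
  by rewrite lee_fin -/u in L *; lra.
apply: (le_trans (curve_length_lip (K := T) _)).
  by move=> a b a0 ab bt; apply: lip => //; apply: le_trans a0.
by rewrite lee_fin -/u in L *; lra.
Qed.

End ChainToArc.

(** * Chains along a path *)

Section FineChain.
Context {R : realType} {E : normedModType R}.
Implicit Types (G : set E) (x y : E) (g : R -> E).

(** Continuous induction on the times that a chain can reach: near any point of the path, every two
    points form a step, so the supremum is reached and equals [b]. *)
Lemma fine_chain G g (a b : R) : open G -> bd G !=set0 -> a <= b -> cont_on a b g ->
  (forall t, a <= t <= b -> G (g t)) ->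
  exists ts, [/\ path <%R a ts, last a ts = b & path (step G) (g a) (map g ts)].
Proof.
move=> oG Gb ab cg Gg.
pose ok t := exists ts, [/\ path <%R a ts, last a ts = t & path (step G) (g a) (map g ts)].
pose S := [set t | a <= t <= b /\ ok t].
have okS t u : S t -> t <= u -> u <= b -> step G (g t) (g u) -> S u.
  move=> [/andP[at_ tb] [ts [p l st]]]; rewrite le_eqVlt => /predU1P[<-|tu] ub sg.
    by split; [rewrite at_|exists ts].
  split; first by rewrite (le_trans at_ (ltW tu)).
  exists (rcons ts u); rewrite last_rcons rcons_path p l tu map_rcons rcons_path st last_map l.
  by split.
have Sa : S a by split; [rewrite lexx|exists [::]].
have hS : has_sup S by split; [exists a|exists b => t [/andP[]]].
have sa : a <= sup S by exact: sup_upper_bound.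
have sb : sup S <= b by apply: ge_sup; [exists a|move=> t [/andP[]]].
have sab : a <= sup S <= b by rewrite sa.
have dpos := bd_dist_gt0 oG Gb (Gg _ sab).
set D := bd_dist G (g (sup S)) in dpos.
(* Two points within D / 8 of [g (sup S)] are at most D / 4 apart and have boundary distance at
   least 7D / 8. *)
have [del del0 H] := cg _ sab (D / 8) (ltac:(by rewrite divr_gt0)).
have near t u : a <= t <= b -> a <= u <= b -> `|t - sup S| < del -> `|u - sup S| < del ->
    step G (g t) (g u).
  move=> tab uab td ud; have Ht := H t tab td; have Hu := H u uab ud.
  have := bd_dist_lip (g (sup S)) (g t) Gb; have := bd_dist_lip (g (sup S)) (g u) Gb.
  have := ler_triangle (g t) (g u) (g (sup S));
    rewrite (distrC (g (sup S)) (g u)) (distrC (g (sup S)) (g t)) -/D.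
  by move=> H1 H2 H3; apply/andP; split; lra.
have [t St lt] := sup_adherent del0 hS.
have tsup : t <= sup S by exact: sup_upper_bound.
pose u := Num.min b (sup S + del / 2).
have ub : u <= b by rewrite ge_min lexx.
have usup : sup S <= u by rewrite le_min sb lerDl divr_ge0// ltW.
have ud : u <= sup S + del / 2 by rewrite ge_min lexx orbT.
have tab : a <= t <= b by have [] := St.
have Su : S u.
  apply: (okS t) => //; first by lra.
  apply: near => //; first by apply/andP; split; lra.
    by rewrite ler0_norm ?subr_le0//; lra.
  by rewrite ger0_norm ?subr_ge0//; lra.
have uE : u = b.
  have : u <= sup S by exact: sup_upper_bound.
  by rewrite {1}/u ge_min => /orP[bs|?]; [apply/eqP; rewrite eq_le ub (le_trans bs)|lra].
by rewrite uE in Su; have [] := Su.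
Qed.

Lemma segment_chain G p q : open G -> bd G !=set0 -> G p ->
  (forall t : R, 0 <= t <= 1 -> ~ bd G (p + t *: (q - p))) ->
  exists ts, [/\ path <%R 0 ts, last 0 ts = 1,
    path (step G) p (map (fun t => p + t *: (q - p)) ts) &
    last p (map (fun t => p + t *: (q - p)) ts) = q].
Proof.
move=> oG Gb Gp av; pose g (t : R) := p + t *: (q - p).
have cg : cont_on 0 1 g.
  apply: (@lip_cont_on _ _ _ _ _ `|q - p|) => s t s0 st t1.
  by rewrite seg_dist ger0_norm ?subr_ge0// mulrC.
have [ts [pts lts sts]] := fine_chain oG Gb ler01 cg (segment_in oG Gp av).
have g0 : g 0 = p by rewrite /g scale0r addr0.
have g1 : g 1 = q by rewrite /g scale1r subrKC.
by exists ts; rewrite -/g -g0 last_map lts g1.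
Qed.

Lemma path_lt_pairwise (a b : R) ts : path <%R a ts -> last a ts = b ->
  pairwise <=%R (a :: ts) /\ forall t, t \in a :: ts -> a <= t <= b.
Proof.
elim: ts a => [a _ /= <-|h ts IH a].
  by split=> // t; rewrite inE => /eqP ->; rewrite lexx.
move=> /=/andP[ah p] l; have [pw bds] := IH h p l.
have hb : h <= b by have /andP[] := bds h (mem_head _ _).
split.
  move: pw => /= ->; rewrite andbT (ltW ah) /=; apply/allP => t tt.
  have /andP[ht _] := bds t (mem_behead (tt : t \in behead (h :: ts))).
  exact: le_trans (ltW ah) ht.
move=> t; rewrite inE => /predU1P[->|/bds/andP[ht ->]].
  by rewrite lexx (le_trans (ltW ah)).
by rewrite (le_trans (ltW ah)).
Qed.

End FineChain.

(** * Turning around a point *)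

Section Turning.
Context {R : realType} {E : normedModType R}.
Implicit Types (u v w : E).

(** Riesz's lemma for a line, with the constant 1 because a nearest point exists by compactness. *)
Lemma unit_far_from_line u : dim_ge2 E -> exists2 w : E, `|w| = 1 &
  forall lam : R, 1 <= `|w - lam *: u|.
Proof.
move=> [e1 [e2 ind]].
have [w0 Hw0] : exists w0 : E, forall lam : R, w0 != lam *: u.
  apply: contrapT => H.
  have col (e : E) : exists lam : R, e = lam *: u.
    by apply: contrapT => He; apply: H; exists e => lam; apply/eqP => E1; apply: He; exists lam.
  have [a1 E1] := col e1; have [a2 E2] := col e2.
  have [a20 a10] : a2 = 0 /\ - a1 = 0.
    by apply: ind; rewrite E1 E2 !scalerA mulNr mulrC scaleNr subrr.
  have e10 : e1 = 0 by rewrite E1; move/eqP: a10; rewrite oppr_eq0 => /eqP ->; rewrite scale0r.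
  have [/eqP] : 1 = 0 :> R /\ 0 = 0 :> R by apply: ind; rewrite e10 scaler0 scale0r addr0.
  by rewrite oner_eq0.
have w00 : 0 < `|w0| by rewrite normr_gt0; have := Hw0 0; rewrite scale0r.
have [lam0 Hmin] : exists lam0 : R, forall lam : R, `|w0 - lam0 *: u| <= `|w0 - lam *: u|.
  have [->|u0] := eqVneq u 0; first by exists 0 => lam; rewrite !scaler0.
  have nu : 0 < `|u| by rewrite normr_gt0.
  (* For |lam| > K the distance from [w0] exceeds |w0|, its value at lam = 0, so the minimum over
     [-K, K] is global. *)
  pose K := 2 * `|w0| / `|u|.
  have K0 : 0 <= K by rewrite divr_ge0// mulr_ge0.
  have KK : - K <= K by lra.
  have cn : {within `[- K, K], continuous (fun lam : R => `|lam *: u - w0|)}.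
    apply/within_cont_on/cont_on_dist/(@lip_cont_on _ _ _ _ _ `|u|) => s t _ st _.
    by rewrite -scalerBl normrZ ger0_norm ?subr_ge0// mulrC.
  have [lam0 _ H] := EVT_min KK cn.
  exists lam0 => lam; rewrite (distrC w0) (distrC w0); have [lK|lK] := leP `|lam| K.
    by apply: H; rewrite in_itv /= -ler_norml.
  apply: (@le_trans _ _ `|w0|).
    by have := H 0; rewrite scale0r sub0r normrN; apply; rewrite in_itv /=; apply/andP;
      split; lra.
  have : 2 * `|w0| < `|lam| * `|u| by rewrite -ltr_pdivrMr.
  have := ler_triangle (lam *: u) 0 w0; rewrite !subr0 normrZ; lra.
set m := `|w0 - lam0 *: u| in Hmin.
have m0 : 0 < m by rewrite normr_gt0 subr_eq0.
exists (m^-1 *: (w0 - lam0 *: u)).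
  by rewrite normrZ ger0_norm ?invr_ge0 ?ltW// mulVf// gt_eqF.
move=> lam.
have -> : m^-1 *: (w0 - lam0 *: u) - lam *: u = m^-1 *: (w0 - (lam0 + m * lam) *: u).
  rewrite !scalerBr scalerDl scalerDr !scalerA mulrA mulVf ?gt_eqF// mul1r.
  by rewrite opprD addrA.
have mi : 0 < m^-1 by rewrite invr_gt0.
rewrite normrZ (gtr0_norm mi) ler_pdivlMl// mulr1.
exact: Hmin.
Qed.

(** If the segment from u to v passes close to 0, then v is close to -u. A unit vector w far from
    the line of u is then joined safely to u and to -u, hence also to v. *)
Lemma unit_turn u v : dim_ge2 E -> `|u| = 1 -> `|v| = 1 ->
  exists w : E, [/\ `|w| = 1,
    (forall s : R, 0 <= s <= 1 -> 1 / 64 <= `|u + s *: (w - u)|) &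
    (forall s : R, 0 <= s <= 1 -> 1 / 64 <= `|w + s *: (v - w)|)].
Proof.
move=> d2 u1 v1.
have [ok|] := pselect (forall s : R, 0 <= s <= 1 -> 1 / 64 <= `|u + s *: (v - u)|).
  exists v; split => // s s01; rewrite subrr scaler0 addr0 v1; lra.
move=> /existsNP[s0 /not_implyP[/andP[s00 s01] /negP]]; rewrite -ltNge => lt.
have [w w1 far] := unit_far_from_line u d2.
exists w.
have dec (a b : E) (s : R) : a + s *: (b - a) = (1 - s) *: a + s *: b.
  by rewrite scalerBr scalerBl scale1r addrA addrAC.
(* For s <= 3/4 the distance of [w] from the line gives at least 1 - s; for larger s the two norms
   differ by 2s - 1. *)
have away (s t : R) : 0 <= s -> s <= 1 -> `|t| = s -> 1 / 8 <= `|(1 - s) *: w - t *: u|.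
  move=> sge0 s1 ts; have [h|h] := leP s (3 / 4).
    have lam1 : 0 < 1 - s by lra.
    have -> : (1 - s) *: w - t *: u = (1 - s) *: (w - (t / (1 - s)) *: u).
      by rewrite scalerBr scalerA mulrC divfK ?gt_eqF.
    rewrite normrZ ger0_norm ?ltW//; have := far (t / (1 - s)).
    set z := `|_|; nra.
  have := ler_triangle (t *: u) 0 ((1 - s) *: w).
  rewrite subr0 normrZ u1 ts subr0 normrZ w1 distrC ger0_norm; lra.
split => // s /andP[sge0 s1].
  have := away (1 - s) (- (1 - s)); rewrite normrN ger0_norm ?subr_ge0// subKr.
  rewrite scaleNr opprK dec [X in _ <= `|X|]addrC => H; apply: le_trans (H _ _ erefl) => //; lra.
set z := u + s0 *: (v - u) in lt.
(* Both summands are small: |z| < 1/64, and comparing the norms of (1 - s0) u and s0 v puts s0 near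
   1/2. *)
have uv : u + v = 2 *: z + (2 * s0 - 1) *: (u - v).
  rewrite /z scalerDr scalerA -[v - u]opprB scalerN scalerBl scale1r addrA subrK.
  by rewrite opprB scaler_nat mulr2n -addrA subrKC.
have small : `|2 * s0 - 1| <= 1 / 64.
  have e1 : z = (1 - s0) *: u + s0 *: v by exact: dec.
  have h1 : 1 - s0 <= `|z| + s0.
    have -> : 1 - s0 = `|(1 - s0) *: u| by rewrite normrZ u1 mulr1 ger0_norm// subr_ge0.
    have -> : (1 - s0) *: u = z - s0 *: v by rewrite e1 addrK.
    by apply: le_trans (ler_normB _ _) _; rewrite normrZ v1 mulr1 (ger0_norm s00).
  have h2 : s0 <= `|z| + (1 - s0).
    have n2 : `|s0 *: v| = s0 by rewrite normrZ v1 mulr1 ger0_norm.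
    rewrite -[leLHS]n2; have -> : s0 *: v = z - (1 - s0) *: u by rewrite e1 addrC addKr.
    apply: le_trans (ler_normB _ _) _.
    by rewrite normrZ u1 mulr1 (@ger0_norm _ (1 - s0)) ?subr_ge0.
  by rewrite ler_norml; apply/andP; split; lra.
have uvs : `|u + v| <= 1 / 16.
  rewrite uv; apply: le_trans (ler_normD _ _) _; rewrite !normrZ ger0_norm//.
  have := ler_normB u v; rewrite u1 v1; have := normr_ge0 (2 * s0 - 1).
  by move: lt small; set a := `|z|; set b := `|_|; set d := `|_|; nra.
have := away s s sge0 s1 (ger0_norm sge0); rewrite dec.
have -> : (1 - s) *: w - s *: u = ((1 - s) *: w + s *: v) - s *: (u + v).
  by rewrite scalerDr opprD addrA addrAC addrK.
move/le_trans => /(_ _ (ler_normB _ _)); rewrite normrZ ger0_norm//.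
move: uvs; set a := `|_|; set b := `|_|; nra.
Qed.

End Turning.

Section TurningChain.
Context {R : realType} {E : normedModType R}.
Implicit Types (G : set E) (u v w : E).

Lemma pairwise_map_time (r : rel E) (g : R -> E) (a b : R) ts :
  path <%R a ts -> last a ts = b ->
  (forall s t, a <= s -> s <= t -> t <= b -> r (g s) (g t)) ->
  pairwise r (g a :: map g ts).
Proof.
move=> p l H; have [pw bds] := path_lt_pairwise p l.
have : pairwise r (map g (a :: ts)); last by [].
rewrite pairwise_map; apply: (sub_in_pairwise (P := [pred t | a <= t <= b])) pw.
  by move=> s t /andP[as_ sb] /andP[at_ tb] st; exact: H.
by apply/allP => t /bds.
Qed.

Lemma map_time_in (P : E -> Prop) (g : R -> E) (a b : R) ts :
  path <%R a ts -> last a ts = b ->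
  (forall t, a <= t <= b -> P (g t)) -> forall z, z \in g a :: map g ts -> P z.
Proof.
move=> p l H z; rewrite -[_ :: _]/(map g (a :: ts)) => /mapP[t tt ->].
by apply: H; have [_] := path_lt_pairwise p l; apply.
Qed.

Lemma path_in G a s : open G -> bd G !=set0 -> G a -> path (step G) a s ->
  forall z, z \in a :: s -> G z.
Proof.
move=> oG Gb; elim: s a => [a Ga _ z|h t IH a Ga]; first by rewrite inE => /eqP ->.
move=> /=/andP[ah pt] z; rewrite inE => /predU1P[->//|].
exact: IH (step_in oG Gb Ga ah) pt z.
Qed.

(** The route consists of two chords at radius |p - o|, which turn to the direction of q, and a
    radial segment out to q. By [unit_turn] the chords keep a distance of at least |p - o| / 64 >=
    2D from o, so they miss the boundary. The pairwise bound says that the route never moves inward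
    by more than the factor 64. *)
Lemma turning G o (D : R) p q : dim_ge2 E -> open G -> bd G !=set0 -> 0 <= D ->
  (forall b, bd G b -> `|b - o| <= D) -> G p ->
  0 < `|p - o| -> `|p - o| <= `|q - o| -> 128 * D <= `|p - o| ->
  exists s, [/\ path (step G) p s, last p s = q,
    pairwise (fun w z => `|w - o| <= 64 * `|z - o|) (p :: s) &
    forall z, z \in p :: s -> `|p - o| <= 64 * `|z - o| /\ `|z - o| <= `|q - o|].
Proof.
move=> d2 oG Gb D0 bD Gp; set P := `|p - o|; set Q := `|q - o| => P0 PQ DP.
have Q0 : 0 < Q by lra.
pose u := P^-1 *: (p - o); pose v := Q^-1 *: (q - o).
have u1 : `|u| = 1.
  by rewrite normrZ ger0_norm ?invr_ge0 ?ltW// mulVf// gt_eqF.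
have v1 : `|v| = 1.
  by rewrite normrZ ger0_norm ?invr_ge0 ?ltW// mulVf// gt_eqF.
have Pu : P *: u = p - o by rewrite scalerA divff ?scale1r// gt_eqF.
have Qv : Q *: v = q - o by rewrite scalerA divff ?scale1r// gt_eqF.
clearbody u v; have [w [w1 uw wv]] := unit_turn d2 u1 v1.
have av z : P <= 64 * `|z - o| -> ~ bd G z by move=> H /bD; lra.
have sphere (a b : E) : G (o + P *: a) -> `|a| = 1 -> `|b| = 1 ->
    (forall s : R, 0 <= s <= 1 -> 1 / 64 <= `|a + s *: (b - a)|) ->
    exists s, [/\ path (step G) (o + P *: a) s, last (o + P *: a) s = o + P *: b &
      forall z, z \in (o + P *: a) :: s -> P <= 64 * `|z - o| /\ `|z - o| <= P].
  move=> Ga a1 b1 ab; pose g (t : R) := o + P *: a + t *: (o + P *: b - (o + P *: a)).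
  have gE t : g t - o = P *: (a + t *: (b - a)).
    have X : o + P *: b - (o + P *: a) = P *: (b - a).
      by rewrite opprD addrACA subrr add0r scalerBr.
    by rewrite /g X scalerA [t * P]mulrC -scalerA -(addrA o) -scalerDr (addrC o) addrK.
  have bds t : 0 <= t <= 1 -> P <= 64 * `|g t - o| /\ `|g t - o| <= P.
    move=> t01; rewrite gE normrZ gtr0_norm//; have H := ab t t01; split; first by nra.
    rewrite ger_pMr//; have /andP[t0 t1] := t01.
    have -> : a + t *: (b - a) = (1 - t) *: a + t *: b.
      by rewrite scalerBr scalerBl scale1r addrA addrAC.
    apply: le_trans (ler_normD _ _) _; rewrite !normrZ a1 b1 !ger0_norm ?subr_ge0//; lra.
  have [ts [pts lts sts es]] := segment_chain (q := o + P *: b) oG Gb Ga (fun t t01 => av (g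
    t) (bds t t01).1).
  have g0 : g 0 = o + P *: a by rewrite /g scale0r addr0.
  exists (map g ts); split => //.
  by rewrite -g0; exact: map_time_in pts lts bds.
have pE : o + P *: u = p by rewrite Pu subrKC.
have [s1 [ps1 ls1 b1]] := sphere u w (ltac:(by rewrite pE)) u1 w1 uw.
have Gw : G (o + P *: w) by rewrite -ls1; apply: path_in ps1 _ (mem_last _ _); rewrite ?pE.
have [s2 [ps2 ls2 b2]] := sphere w v Gw w1 v1 wv.
have Gv : G (o + P *: v) by rewrite -ls2; apply: path_in ps2 _ (mem_last _ _).
pose g (t : R) := o + P *: v + t *: (q - (o + P *: v)).
have gE t : g t - o = (P + t * (Q - P)) *: v.
  have X : q - (o + P *: v) = (Q - P) *: v by rewrite opprD addrA -Qv -scalerBl.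
  by rewrite /g X scalerA -(addrA o) -scalerDl (addrC o) addrK.
have gN t : 0 <= t -> `|g t - o| = P + t * (Q - P).
  by move=> t0; rewrite gE normrZ v1 mulr1 ger0_norm//; nra.
have g0 : g 0 = o + P *: v by rewrite /g scale0r addr0.
have gbd t : 0 <= t <= 1 -> P <= `|g t - o| /\ `|g t - o| <= Q.
  by move=> /andP[t0 t1]; rewrite gN//; split; nra.
have [ts [pts lts sts es]] := segment_chain (q := q) oG Gb Gv
  (fun t t01 => av (g t) (ltac:(have [] := gbd t t01; rewrite /g; lra))).
have b3 : forall z, z \in g 0 :: map g ts -> P <= `|z - o| /\ `|z - o| <= Q.
  exact: map_time_in pts lts gbd.
have pw3 : pairwise (fun w z => `|w - o| <= 64 * `|z - o|) (g 0 :: map g ts).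
  apply: pairwise_map_time pts lts _ => s t s0 st t1.
  by rewrite !gN//; [nra|lra].
exists (s1 ++ s2 ++ map g ts); rewrite -{1 2}pE !cat_path !last_cat ls1 ls2 ps1 ps2 sts es.
have b12 z : z \in p :: s1 ++ s2 -> P <= 64 * `|z - o| /\ `|z - o| <= P.
  rewrite -cat_cons mem_cat -{1}pE => /orP[/b1//|zs]; apply: b2; exact: mem_behead.
have b3' z : z \in map g ts -> P <= `|z - o| /\ `|z - o| <= Q.
  by move=> zs; apply: b3; exact: mem_behead.
split => //; rewrite catA -cat_cons.
  rewrite pairwise_cat; apply/and3P; split.
  - apply/allrelP => a b /b12[_ h1] /b3'[h2 _]; have := normr_ge0 (b - o); lra.
  - apply: (sub_in_pairwise (P := [in p :: s1 ++ s2]) (r := fun _ _ => true)) => //.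
    + by move=> a b /b12[_ h1] /b12[h2 _] _; lra.
    + by elim: (p :: _) => //= a l ->; rewrite andbT; apply/allP.
  - by move: pw3; rewrite pairwise_cons => /andP[].
move=> z; rewrite mem_cat => /orP[/b12[]|/b3'[]]; split=> //; lra.
Qed.

End TurningChain.

(** * Relative cross ratios *)

Section CrossRatio.
Context {R : realType}.

(* With u(p) = |a - p| / |b - p| this reads u(w) <= H max(u(p), u(q)). *)
Definition cr_le {E : normedModType R} (G : set E) (H : R) (p w q : E) : Prop :=
  forall a b, bd G a -> bd G b ->
    `|a - w| * `|b - p| <= H * `|a - p| * `|b - w| \/
    `|a - w| * `|b - q| <= H * `|a - q| * `|b - w|.

Lemma cr_leC {E : normedModType R} (G : set E) (H : R) (p w q : E) :
  cr_le G H p w q -> cr_le G H q w p.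
Proof. by move=> h a b ba bb; case: (h a b ba bb); [right|left]. Qed.

(* Here [A], [Ap], [Aq] stand for the distances of w, p, q to a, the [B]'s for
   those to b, and [e], [s] for |w - p|, |a - b|. *)
Lemma cross_ratio_contradiction (c K A B Ap Bp Aq Bq e s : R) :
  1 <= c -> 1 <= K -> 0 < A -> 0 < B -> 0 <= Ap -> 0 <= Aq -> 0 <= Bp -> 0 <= Bq ->
  e <= c * B -> Bp <= B + e -> A <= Ap + e -> e <= 2 * K * (Ap + Aq) ->
  Bq <= Aq + s -> s <= A + B ->
  32 * K * (c + 1) * Ap * B < A * Bp -> 32 * K * (c + 1) * Aq * B < A * Bq -> False.
Proof.
move=> c1 K1 A0 B0 Ap0 Aq0 Bp0 Bq0 eB Bpe Ae eK Bqs sAB H1 H2.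
have cp : 0 < c + 1 by lra.
(* Since e <= cB, the distances [Bp] and [B] differ at most by the factor 1 + c; the ratio at w can
   beat the one at p only if a is much closer to p than to w. *)
have h1 : 32 * (K * Ap) < A.
  rewrite -(ltr_pM2r cp) -(ltr_pM2r B0).
  have : A * Bp <= A * ((1 + c) * B) by rewrite ler_pM2l//; lra.
  lra.
have ApK : Ap <= K * Ap by rewrite ler_peMl.
have AqK : Aq <= K * Aq by rewrite ler_peMl.
have e1 : A <= 2 * e by lra.
have e2 : A <= 8 * (K * Aq) by lra.
(* As a is close to p, [A] is comparable to e and bounded by [Aq]. Hence [Bq] exceeds [A], [B] and
   [Aq] by factors that contradict Bq <= Aq + A + B. *)
have h2 : 4 * (c + 1) * B < Bq.
  rewrite -(ltr_pM2l A0); apply: le_lt_trans H2.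
  have : (4 * ((c + 1) * B)) * A <= (4 * ((c + 1) * B)) * (8 * (K * Aq)).
    by rewrite ler_pM2l// !mulr_gt0.
  lra.
have Bq0' : 0 < Bq by apply: lt_trans h2; rewrite !mulr_gt0.
have h3 : 16 * (K * Aq) < Bq.
  rewrite -(ltr_pM2l (ltac:(by rewrite mulr_gt0//; lra) : 0 < 2 * (c + 1))) -(ltr_pM2r B0).
  have : A * Bq <= 2 * (c + 1) * B * Bq by rewrite ler_pM2r//; lra.
  lra.
have := mulr_gt0 cp B0; lra.
Qed.

(** The boundary distances of p and q are at most |a - p| and |a - q|, so the last two hypotheses
    bound |w - p| and |w - q| by 2K(|a - p| + |a - q|). By symmetry w may be assumed close to p,
    which leaves an inequality between real numbers. *)
Lemma cr_le_of_cone {E : normedModType R} (G : set E) (c K : R) (p w q : E) :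
  bd G !=set0 -> 1 <= c -> 1 <= K -> 0 < bd_dist G w ->
  `|w - p| <= c * bd_dist G w \/ `|w - q| <= c * bd_dist G w ->
  `|w - p| <= K * (`|p - q| + bd_dist G p + bd_dist G q) ->
  `|w - q| <= K * (`|p - q| + bd_dist G p + bd_dist G q) ->
  cr_le G (32 * K * (c + 1)) p w q.
Proof.
move=> Gb c1 K1.
wlog wp : p q / `|w - p| <= c * bd_dist G w.
  move=> W dw [h|h] h1 h2; first by apply: W => //; left.
  by apply: cr_leC; apply: W => //; [left|rewrite (distrC q) addrAC..].
move=> dw _ h1 _ a b ba bb.
rewrite -[_ \/ _]notK => /not_orP[/negP + /negP].
rewrite -!ltNge => H1 H2.
have dwa := bd_dist_le w ba; have dwb := bd_dist_le w bb.
have dpa := bd_dist_le p ba; have dqa := bd_dist_le q ba.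
apply: (@cross_ratio_contradiction c K `|a - w| `|b - w| `|a - p| `|b - p| `|a - q| `|b - q|
  `|w - p| `|a - b|) => //.
- by rewrite distrC; lra.
- by rewrite distrC; lra.
- rewrite (distrC b); apply: le_trans wp _; rewrite ler_pM2l//; lra.
- exact: ler_triangle.
- by rewrite (distrC w); exact: ler_triangle.
- apply: le_trans h1 _; rewrite (mulrC 2) -[leRHS]mulrA ler_pM2l; last by lra.
  have := ler_triangle p q a; rewrite (distrC p a) in dpa *; rewrite (distrC q a) in dqa; lra.
- by rewrite [leRHS]addrC (distrC a b); exact: ler_triangle.
- by rewrite (distrC b); exact: ler_triangle.
Qed.

(* On [gam] the length condition at [gam t] bounds both |w - x| and
   |w - gam t| by |x - gam t| + d(gam t), even when [gam t] lies on the far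
   half of the arc. *)
Lemma uniform_arc_cr_le {E : normedModType R} (G : set E) (c : R) (x y : E) gam :
  open G -> bd G !=set0 -> 1 <= c -> arc_in G x y gam ->
  (curve_length 0 1 gam <= (c * `|x - y|)%:E)%E ->
  (forall t, 0 <= t <= 1 ->
      (Order.min (curve_length 0 t gam) (curve_length t 1 gam)
         <= (c * bd_dist G (gam t))%:E)%E) ->
  forall s t, 0 <= s -> s <= t -> t <= 1 ->
    cr_le G (32 * (c * c) * (c + 1)) x (gam s) (gam t) /\
    cr_le G (32 * (c * c) * (c + 1)) (gam s) (gam t) y.
Proof.
move=> oG Gb c1 [[_ g0 g1 gG] _] tot cone s t s0 st t1.
have cc : 1 <= c * c by rewrite -[1]mulr1 ler_pM.
have ccc : c <= c * c by rewrite ler_peMl//; lra.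
have G01 u : 0 <= u -> u <= 1 -> G (gam u).
  by move=> u0 u1; apply: gG; exists u => //=; rewrite in_itv /= u0.
have dist (a b u v : R) (M : R) : a <= u -> u <= v -> v <= b ->
    (curve_length a b gam <= M%:E)%E -> `|gam v - gam u| <= M.
  by move=> au uv vb H; rewrite -lee_fin (le_trans _ H)// curve_length_sub.
have split u : 0 <= u -> u <= 1 ->
    (curve_length 0 u gam <= (c * bd_dist G (gam u))%:E)%E \/
    (curve_length u 1 gam <= (c * bd_dist G (gam u))%:E)%E.
  by move=> u0 u1; have := cone u; rewrite u0 u1 => /(_ isT); rewrite ge_min => /orP.
have t0 : 0 <= t := le_trans s0 st.
have s1 : s <= 1 := le_trans st t1.
have ds := bd_dist_ge0 G (gam s); have dt := bd_dist_ge0 G (gam t).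
have dx := bd_dist_ge0 G x; have dy := bd_dist_ge0 G y.
have totd u v : 0 <= u -> u <= v -> v <= 1 -> `|gam v - gam u| <= c * `|x - y|.
  by move=> u0 uv v1; exact: (dist 0 1).
have mono (X Y : R) : 0 <= X -> 0 <= Y -> c * X <= c * c * (X + Y).
  move=> X0 Y0; apply: (@le_trans _ _ (c * c * X)); first by rewrite ler_wpM2r.
  by rewrite ler_pM2l; lra.
split; apply: cr_le_of_cone => //.
- exact: bd_dist_gt0 (G01 s s0 s1).
- case: (split s s0 s1) => H; [left|right].
    by rewrite -g0; exact: (dist 0 s).
  by rewrite distrC; exact: (dist s 1).
- case: (split t t0 t1) => H.
    apply: (@le_trans _ _ (c * bd_dist G (gam t))); first by rewrite -g0; exact: (dist 0 t).
    rewrite addrC; apply: mono => //; exact: addr_ge0.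
  (* On the far half [gam t] is close to y relative to its boundary distance, so |x - y|, and with
     it the whole length, is bounded in terms of |x - gam t| and d(gam t). *)
  have yt : `|y - gam t| <= c * bd_dist G (gam t) by rewrite -g1; exact: (dist t 1).
  have := totd 0 s (lexx _) s0 s1; rewrite g0 => /le_trans; apply.
  have : c * `|x - y| <= c * (`|x - gam t| + `|y - gam t|).
    by rewrite ler_pM2l ?(distrC y)//; [exact: ler_triangle|lra].
  have : c * `|y - gam t| <= c * (c * bd_dist G (gam t)) by rewrite ler_pM2l//; lra.
  have : c * `|x - gam t| <= c * c * `|x - gam t| by rewrite ler_wpM2r.
  have : 0 <= c * c * bd_dist G x by rewrite mulr_ge0//; lra.
  lra.
- case: (split t t0 t1) => H.
    apply: (@le_trans _ _ (c * bd_dist G (gam t))); first by rewrite distrC; exact: (dist 0 t).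
    rewrite addrC; apply: mono => //; exact: addr_ge0.
  have yt : `|y - gam t| <= c * bd_dist G (gam t) by rewrite -g1; exact: (dist t 1).
  have := totd s t s0 st t1; rewrite distrC => /le_trans; apply.
  have : c * `|x - y| <= c * (`|x - gam t| + `|y - gam t|).
    by rewrite ler_pM2l ?(distrC y)//; [exact: ler_triangle|lra].
  have : c * `|y - gam t| <= c * (c * bd_dist G (gam t)) by rewrite ler_pM2l//; lra.
  have : c * `|x - gam t| <= c * c * `|x - gam t| by rewrite ler_wpM2r.
  have : 0 <= c * c * bd_dist G x by rewrite mulr_ge0//; lra.
  lra.
- exact: bd_dist_gt0 (G01 t t0 t1).
- case: (split t t0 t1) => H; [left|right].
    by exact: (dist 0 t).
  by rewrite -g1 distrC; exact: (dist t 1).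
- case: (split s s0 s1) => H; last first.
    apply: (@le_trans _ _ (c * bd_dist G (gam s))); first by exact: (dist s 1).
    rewrite addrAC addrC; apply: mono => //; exact: addr_ge0.
  have xs : `|x - gam s| <= c * bd_dist G (gam s) by rewrite distrC -g0; exact: (dist 0 s).
  have := totd s t s0 st t1 => /le_trans; apply.
  have : c * `|x - y| <= c * (`|x - gam s| + `|gam s - y|).
    by rewrite ler_pM2l; [exact: ler_triangle|lra].
  have : c * `|x - gam s| <= c * (c * bd_dist G (gam s)) by rewrite ler_pM2l//; lra.
  have : c * `|gam s - y| <= c * c * `|gam s - y| by rewrite ler_wpM2r.
  have : 0 <= c * c * bd_dist G y by rewrite mulr_ge0//; lra.
  lra.
- case: (split s s0 s1) => H; last first.
    apply: (@le_trans _ _ (c * bd_dist G (gam s))).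
      by rewrite -g1 distrC; exact: (dist s 1).
    rewrite addrAC addrC; apply: mono => //; exact: addr_ge0.
  have xs : `|x - gam s| <= c * bd_dist G (gam s) by rewrite distrC -g0; exact: (dist 0 s).
  have := totd t 1 t0 t1 (lexx _); rewrite g1 distrC => /le_trans; apply.
  have : c * `|x - y| <= c * (`|x - gam s| + `|gam s - y|).
    by rewrite ler_pM2l; [exact: ler_triangle|lra].
  have : c * `|x - gam s| <= c * (c * bd_dist G (gam s)) by rewrite ler_pM2l//; lra.
  have : c * `|gam s - y| <= c * c * `|gam s - y| by rewrite ler_wpM2r.
  have : 0 <= c * c * bd_dist G y by rewrite mulr_ge0//; lra.
  lra.
Qed.

(** The quotient u(w) / u(z) is the cross ratio of a, z, w, b, whose outer points lie on the
    boundary. Quadruples must be distinct; for a = b or w = z the quotient is 1, which is covered by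
    [1 <= H]. *)
Lemma cr_le_transfer {E E' : normedModType R} (G : set E) (G' : set E') (f : E -> E')
    (eta : R -> R) (L H : R) :
  set_bij (closure G) (closure G') f ->
  quasimoebius_rel eta (Some @` closure G) (Some @` bd G) (omap f) ->
  f @` G = G' -> 1 <= H -> (forall s, 0 <= s <= L -> eta s <= H) ->
  forall p w q, G p -> G w -> G q -> cr_le G L p w q -> cr_le G' H (f p) (f w) (f q).
Proof.
move=> [fto finj fsurj] [_ qm] fG H1 etaH p w q Gp Gw Gq cr.
have bdf b' : bd G' b' -> exists2 b, bd G b & f b = b'.
  move=> [/fsurj[b cb <-] nb]; exists b => //; split => // Gb.
  by apply: nb; rewrite -fG; exists b.
have cG z : G z -> closure G z by move=> Gz; exact: subset_closure.
have fne z1 z2 : closure G z1 -> closure G z2 -> z1 != z2 -> f z1 != f z2.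
  by move=> c1 c2; apply: contraNneq => /finj -> //; rewrite inE.
have neb b z : bd G b -> G z -> b != z by move=> [_ nG] Gz; apply/eqP => e; rewrite e in nG.
have main a b z : bd G a -> bd G b -> a != b -> G z ->
    `|a - w| * `|b - z| <= L * `|a - z| * `|b - w| ->
    `|f a - f w| * `|f b - f z| <= H * `|f a - f z| * `|f b - f w|.
  move=> ba bb ab Gz h.
  have [<-|wz] := eqVneq w z.
    by rewrite -mulrA ler_peMl// mulr_ge0.
  have [ca cb] : closure G a /\ closure G b by case: ba; case: bb.
  have az : 0 < `|a - z| by rewrite normr_gt0 subr_eq0 neb.
  have bw : 0 < `|b - w| by rewrite normr_gt0 subr_eq0 neb.
  have az' : 0 < `|f a - f z| by rewrite normr_gt0 subr_eq0 fne ?neb//; exact: cG.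
  have bw' : 0 < `|f b - f w| by rewrite normr_gt0 subr_eq0 fne ?neb//; exact: cG.
  have := qm (Some a) (Some z) (Some w) (Some b).
  rewrite /cross_ratio /= => /(_ _ _ _ _ _ _) h'.
  have {h'} : `|f a - f w| / `|f a - f z| * (`|f z - f b| / `|f w - f b|) <=
     eta (`|a - w| / `|a - z| * (`|z - b| / `|w - b|)).
    apply: h'; [by exists a|by exists z; [exact: cG|]|by exists w; [exact: cG|]|by exists b| |].
      have ne z1 z2 : z1 != z2 -> (Some z1 == Some z2 :> option E) = false.
        by move=> /negbTE e; rewrite (inj_eq Some_inj).
      have zb : z != b by rewrite eq_sym neb.
      have wb : w != b by rewrite eq_sym neb.
      have zw : z != w by rewrite eq_sym.
      by rewrite /= !inE (ne _ _ (neb a z ba Gz)) (ne _ _ (neb a w ba Gw)) !ne.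
    by left; split; [exists a|exists b].
  move/le_trans => /(_ H); rewrite etaH => [/(_ isT)|].
    rewrite mulrACA -invfM ler_pdivrMr ?mulr_gt0 ?(distrC (f w))// (distrC (f z)).
    by rewrite mulrA.
  rewrite mulrACA -invfM (distrC w) (distrC z) divr_ge0 ?mulr_ge0//=.
  by rewrite ler_pdivrMr ?mulr_gt0// mulrA.
move=> _ _ /bdf[a ba <-] /bdf[b bb <-].
have [<-|ab] := eqVneq a b.
  left; rewrite mulrAC -mulrA ler_peMl ?mulr_ge0//.
by case: (cr a b ba bb) => h; [left|right]; exact: main.
Qed.

End CrossRatio.

(** * Chains in the image domain *)

Section Target.
Context {R : realType} {E : normedModType R}.
Variable G : set E.
Hypotheses (oG : open G) (Gb : bd G !=set0).
Implicit Types (x y z w p q : E).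

(** Supplies the distant second reference point b once a has been chosen near the point under
    study. *)
Definition bd_spread (D : R) := 0 < D /\
  forall a, bd G a -> exists2 b, bd G b & D <= `|b - a|.

(** Choose a within 2d(z) of z and b far from a. Unless D is at most 10 H d(z), the ratio |b - z| /
    |a - z| is large; so it is large at x or y as well, which puts that endpoint near a and hence
    near z. *)
Lemma cr_le_end_close (H D : R) x z y : 1 <= H -> G z -> bd_spread D -> cr_le G H x z y ->
  [\/ `|x - z| <= 10 * H * bd_dist G z, `|y - z| <= 10 * H * bd_dist G z |
      D <= 10 * H * bd_dist G z].
Proof.
move=> H1 Gz [D0 spread] cr.
have dz := bd_dist_gt0 oG Gb Gz; set d := bd_dist G z in dz *.
have [a ba az] := bd_dist_near Gb dz; rewrite -/d in az.
have [b bb ab] := spread a ba.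
have HH : 0 < H by lra.
have Hd : d <= H * d by rewrite ler_peMl// ltW.
have key u : `|b - z| * `|a - u| <= H * `|b - u| * `|a - z| ->
    `|u - z| <= 10 * H * d \/ D <= 10 * H * d.
  move=> h; have [|uz] := leP `|u - z| (10 * H * d); first by left.
  right; rewrite leNgt; apply/negP => DD; move: h; apply/negP; rewrite -ltNge.
  have au : `|u - z| <= `|a - u| + 2 * d.
    by apply: (le_trans (ler_triangle u z a)); rewrite (distrC u a) (distrC a z) lerD2l.
  have bu : `|b - u| <= `|b - a| + `|a - u| by exact: ler_triangle.
  have bz : `|b - a| <= `|b - z| + 2 * d.
    by apply: (le_trans (ler_triangle b a z)); rewrite lerD2l.
  set U := `|a - u| in au bu *; set B := `|b - a| in ab bu bz.
  have U8 : 8 * (H * d) < U by lra.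
  have B8 : 8 * (H * d) < B by lra.
  have Hd0 : 0 < H * d by rewrite mulr_gt0.
  apply: (@le_lt_trans _ _ (H * (B + U) * (2 * d))).
    by rewrite -!mulrA ler_pM2l//; apply: ler_pM => //; rewrite distrC.
  apply: (@lt_le_trans _ _ (B / 2 * U)); last by rewrite ler_wpM2r//; [rewrite /U|lra].
  have B0 : 0 < B by lra.
  have U0 : 0 < U by lra.
  have : 8 * (H * d) * B < U * B by rewrite ltr_pM2r.
  have : 8 * (H * d) * U < B * U by rewrite ltr_pM2r.
  lra.
by case: (cr b a bb ba) => /key[]; [constructor 1|constructor 3|constructor 2|constructor 3].
Qed.

(** Now a is near both x and z, so the inverse ratio |a - .| / |b - .| is small at both; it is then
    small at w, and w is near a. *)
Lemma cr_le_between_close (H C D : R) x w z : 1 <= H -> 1 <= C -> G z -> bd_spread D ->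
  `|x - z| <= C * bd_dist G z -> cr_le G H x w z ->
  `|w - x| <= 5 * H * (C + 2) * bd_dist G z \/ D <= 5 * H * (C + 2) * bd_dist G z.
Proof.
move=> H1 C1 Gz [D0 spread] xz cr.
have dz := bd_dist_gt0 oG Gb Gz; set d := bd_dist G z in dz xz *.
have [a ba az] := bd_dist_near Gb dz; rewrite -/d in az.
have [b bb ab] := spread a ba.
have HH : 0 < H by lra.
have [DD|DD] := leP D (5 * H * (C + 2) * d); [by right|left].
have [e eE] : exists e : R, e = (C + 2) * d by eexists.
have e0 : 0 < e by rewrite eE mulr_gt0//; lra.
have He : e <= H * e by rewrite ler_peMl// ltW.
have Cd : 0 < C * d by rewrite mulr_gt0//; lra.
have ax : `|a - x| <= e.
  apply: (le_trans (ler_triangle a x z)); rewrite (distrC a) (distrC z x) eE; lra.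
have az' : `|a - z| <= e by rewrite distrC eE; lra.
have DD' : 5 * (H * e) < `|b - a| by rewrite eE; lra.
set B := `|b - a| in ab DD'.
have key u : `|a - u| <= e -> `|a - w| * `|b - u| <= H * `|a - u| * `|b - w| ->
    `|a - w| <= 4 * (H * e).
  move=> au h; set W := `|a - w| in h *.
  have bu : B / 2 <= `|b - u|.
    have := ler_triangle b a u; rewrite -/B (distrC u); lra.
  have bw : `|b - w| <= B + W by exact: ler_triangle.
  rewrite leNgt; apply/negP => WW; move: h; apply/negP; rewrite -ltNge.
  apply: (@le_lt_trans _ _ (H * e * (B + W))).
    rewrite -[leLHS]mulrA -[leRHS]mulrA ler_pM2l//; apply: ler_pM => //; exact: normr_ge0.
  apply: (@lt_le_trans _ _ (W * (B / 2))); last by rewrite ler_wpM2l// /W.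
  have W0 : 0 < W by lra.
  have B0 : 0 < B by lra.
  have := mulr_gt0 W0 B0; have : 4 * (H * e) * B < W * B by rewrite ltr_pM2r.
  have : 5 * (H * e) * W < B * W by rewrite ltr_pM2r.
  lra.
have aw : `|a - w| <= 4 * (H * e) by case: (cr a b ba bb) => /key; exact.
apply: (le_trans (ler_triangle w x a)); rewrite (distrC w).
have -> : 5 * H * (C + 2) * d = 5 * (H * e) by rewrite eE; lra.
lra.
Qed.

(** What remains of a uniform arc after applying [f]: the three-point inequalities, without any
    bound on length or diameter. *)
Definition good_path (H : R) x y (al : R -> E) :=
  [/\ cont_on 0 1 al, al 0 = x, al 1 = y, (forall t, 0 <= t <= 1 -> G (al t)) &
   forall s t, 0 <= s -> s <= t -> t <= 1 ->
     cr_le G H x (al s) (al t) /\ cr_le G H (al s) (al t) y].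

Lemma good_path_rev H x y al : good_path H x y al -> good_path H y x (fun t => al (1 - t)).
Proof.
move=> [cal a0 a1 aG acr]; split.
- apply: (@cont_on_comp_lip _ _ 0 1 0 1 al (fun t => 1 - t) 1) => //.
    by move=> s /andP[s0 s1]; apply/andP; split; lra.
  by move=> s t _ _; rewrite mul1r opprB addrC addrA subrK distrC.
- by rewrite subr0.
- by rewrite subrr.
- by move=> t /andP[t0 t1]; apply: aG; apply/andP; split; lra.
- move=> s t s0 st t1; have [|||h1 h2] := acr (1 - t) (1 - s); [lra..|].
  by split; apply: cr_leC.
Qed.

(** [cr_le_end_close] finds the endpoint near [al t], with constant 10H; [cr_le_between_close] then
    keeps the part up to it near as well. The product 5H(10H + 2) is at most 60 H^2. *)
Lemma good_path_local (H D : R) x y al : 1 <= H -> good_path H x y al -> bd_spread D ->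
  forall t, 0 <= t <= 1 -> let C := 60 * (H * H) * bd_dist G (al t) in
  [\/ forall s, 0 <= s <= t -> `|al s - x| <= C,
      forall s, t <= s <= 1 -> `|al s - y| <= C | D <= C].
Proof.
move=> H1 gp; have [cal a0 a1 aG acr] := gp; move=> spr t /andP[t0 t1] C.
have Gt : G (al t) by apply: aG; rewrite t0.
have dt := bd_dist_gt0 oG Gb Gt.
have H10 : 1 <= 10 * H by lra.
have HH : H <= H * H by rewrite ler_peMl//; lra.
have le1 : 5 * H * (10 * H + 2) * bd_dist G (al t) <= C.
  by rewrite /C ler_pM2r//; lra.
have le2 : 10 * H * bd_dist G (al t) <= C by rewrite /C ler_pM2r//; lra.
have crt : cr_le G H x (al t) y by rewrite -a1; apply: (acr t 1 _ _ _).1.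
have [h|h|h] := cr_le_end_close H1 Gt spr crt; last by constructor 3; lra.
  have [DC|DC] := leP D C; [by constructor 3|constructor 1 => s /andP[s0 st]].
  have [] := cr_le_between_close H1 H10 Gt spr h (acr s t s0 st t1).1; lra.
have [DC|DC] := leP D C; [by constructor 3|constructor 2 => s /andP[ts s1]].
have [] := cr_le_between_close H1 H10 Gt spr h (cr_leC (acr t s t0 ts s1).2); lra.
Qed.

(** [M] measures distances from the first point; changing that point costs one |x - y|. *)
Lemma dchain_rev M c x y : dchain G M c y x -> dchain G (M + 1) c x y.
Proof.
move=> [n [v [[v0 vn st] tot loc]]]; exists n, (fun i => v (n - i)%N); split.
- split; rewrite ?subn0 ?subnn//.
  by move=> i ilt; rewrite stepC -(subnSK ilt); apply: st;
    rewrite ltn_subrL (leq_ltn_trans _ ilt).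
- move=> i ilt; apply: (le_trans (ler_triangle _ _ y)); rewrite (distrC y) mulrDl mul1r lerD2r.
  by rewrite (distrC x); apply: tot; exact: leq_subr.
- move=> i ilt; case: (loc (n - i)%N (leq_subr _ _)) => h; [right|left] => j.
    by move=> /andP[ij jn]; apply: h; exact: leq_sub2l.
  by move=> ji; apply: h; rewrite leq_sub2l// leq_subr.
Qed.

Lemma dchain_weaken M c x y : M <= c -> dchain G M c x y -> dchain G c c x y.
Proof.
move=> Mc [n [v [ch tot loc]]]; exists n, v; split => // i ilt.
by apply: le_trans (tot i ilt) _; rewrite ler_wpM2r.
Qed.

(** If the third alternative of [good_path_local] occurs, the bound K D on the whole path gives the
    condition towards x, at the cost of the factor [K]. *)
Lemma dchain_path (H D K M : R) x y al : 1 <= H -> 1 <= K -> good_path H x y al -> bd_spread D ->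
  (forall t, 0 <= t <= 1 -> `|al t - x| <= K * D /\ `|al t - x| <= M * `|x - y|) ->
  dchain G M (60 * K * (H * H)) x y.
Proof.
move=> H1 K1 gp spr bds; have [cal a0 a1 aG acr] := gp.
have [ts [pts lts sts]] := fine_chain oG Gb ler01 cal aG.
have [pw tin] := path_lt_pairwise pts lts.
pose tm i := nth 1 (0 :: ts) i.
have tm01 i : (i <= size ts)%N -> 0 <= tm i <= 1 by move=> ilt; apply: tin; exact: mem_nth.
exists (size ts), (al \o tm); split.
- split; first by [].
    by rewrite /= /tm -last_nth lts a1.
  move=> i ilt /=; have /(pathP (al 1)) := sts; rewrite size_map => /(_ i ilt).
  by rewrite -map_cons (nth_map 1) 1?ltnW// (nth_map 1).
- by move=> i /tm01/bds[].
- move=> i ilt /=.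
  have C60 : 60 * (H * H) * bd_dist G (al (tm i)) <= 60 * K * (H * H) * bd_dist G (al (tm i)).
    rewrite ler_wpM2r ?bd_dist_ge0// ler_wpM2r ?mulr_ge0//; lra.
  have mono j k : (j <= k)%N -> (k <= size ts)%N -> tm j <= tm k.
    rewrite leq_eqVlt => /predU1P[->//|jk] kn.
    by move/(pairwiseP 1): pw => /(_ j k); apply => //;
      rewrite inE /= ltnS// ltnW// (leq_trans jk).
  have [h|h|h] := good_path_local H1 gp spr (tm01 i ilt).
  + left=> j ji; apply: le_trans C60; apply: h.
    by have /andP[-> _] := tm01 j (leq_trans ji ilt); exact: mono.
  + right=> j /andP[ij jn]; apply: le_trans C60; apply: h.
    by have /andP[_ ->] := tm01 j jn; rewrite mono.
  + left=> j ji; have [h1 _] := bds _ (tm01 j (leq_trans ji ilt)).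
    apply: le_trans h1 _.
    have : K * D <= K * (60 * (H * H) * bd_dist G (al (tm i))) by rewrite ler_pM2l//; lra.
    lra.
Qed.

(** Vertices of [A] satisfy the condition towards x, those of [B] the one towards y. Pairwise
    relations on lists behave well under concatenation, which is how the replaced path is
    assembled. *)
Lemma dchain_lists (M c : R) x y A B : path (step G) x (A ++ B) -> last x (A ++ B) = y ->
  (forall z, z \in x :: A ++ B -> `|z - x| <= M * `|x - y|) ->
  pairwise (fun w z => `|w - x| <= c * bd_dist G z) (x :: A) ->
  (forall z, z \in x :: A -> `|z - x| <= c * bd_dist G z) ->
  pairwise (fun z w => `|w - y| <= c * bd_dist G z) B ->
  (forall z, z \in B -> `|z - y| <= c * bd_dist G z) ->
  dchain G M c x y.
Proof.
move=> pAB lAB tot pA rA pB rB.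
pose v i := nth y (x :: A ++ B) i.
exists (size (A ++ B)), v; split.
- split=> //.
    by rewrite /v -last_nth lAB.
  by move=> i ilt; have /(pathP y) := pAB => /(_ i ilt).
- by move=> i ilt; apply: tot; exact: mem_nth.
- have vE i : v i = nth y ((x :: A) ++ B) i by [].
  move=> i ilt; have [iA|iA] := leqP i (size A); [left=> j ji|right => j /andP[ij jn]].
    have jA : (j <= size A)%N := leq_trans ji iA.
    rewrite !vE !nth_cat /= !ltnS iA jA.
    move: ji; rewrite leq_eqVlt => /predU1P[->|ji]; first by apply: rA; exact: mem_nth.
    by move/(pairwiseP y): pA; apply; rewrite ?inE /= ?ltnS.
  rewrite size_cat in ilt jn.
  have jA : (size A < j)%N := leq_trans iA ij.
  have nA k : (size A < k)%N -> (k < size (x :: A))%N = false by move=> h; rewrite ltnS leqNgt h.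
  rewrite !vE !nth_cat !nA// [size (x :: A)]/=.
  have iB : (i - (size A).+1 < size B)%N by rewrite ltn_subLR// addSn ltnS.
  have jB : (j - (size A).+1 < size B)%N by rewrite ltn_subLR// addSn ltnS.
  move: ij; rewrite leq_eqVlt => /predU1P[->|ij]; first by apply: rB; exact: mem_nth.
  by move/(pairwiseP y): pB; apply; rewrite ?inE// ltn_sub2r// (leq_ltn_trans iA).
Qed.

End Target.

(** * Detour around a bounded boundary *)

Section Bounded.
Context {R : realType} {E : normedModType R}.
Variable G : set E.
Hypotheses (d2 : dim_ge2 E) (oG : open G) (Gb : bd G !=set0).
Implicit Types (x y z w p q : E).

(* The case [|al s - y| <= C d(al t)] for all s >= t, which [good_path_local]
   leaves open, is harmless since [al t1] is far from the boundary. *)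
Lemma half_path (H C D : R) o x y al (t0 : R) : 1 <= H -> 60 * 32 * 32 * (H * H) <= C ->
  good_path G H x y al -> 0 <= D ->
  (forall b, bd G b -> `|b - o| <= D) -> (0 < D -> bd_spread G (D / 4)) ->
  0 <= t0 <= 1 -> 128 * D <= `|al t0 - o| ->
  exists t1, [/\ 0 <= t1 <= t0, `|al t1 - o| = Num.max (128 * D) `|x - o|,
    (forall s, 0 <= s <= t1 -> `|al s - o| <= `|al t1 - o|) &
    forall s t, 0 <= s -> s <= t -> t <= t1 ->
      `|al s - x| <= C * bd_dist G (al t)].
Proof.
move=> H1 hC gp D0 bD spr t001 hit; have [cal a0 a1 aG acr] := gp.
have HH : 1 <= H * H by rewrite -[1]mulr1 ler_pM.
have C0 : 0 <= C by lra.
have [t00 t01] := andP t001.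
have [xD|xD] := leP (128 * D) `|x - o|.
  exists 0; rewrite lexx t00 a0; split => //.
    by move=> s s0; have -> : s = 0 by [lra]; rewrite a0.
  move=> s t s0 st t1; have -> : s = 0 by lra.
  by rewrite a0 subrr normr0; apply: mulr_ge0 => //; exact: bd_dist_ge0.
have [t1 [t1b g1 gle]] := first_hit (cont_on_dist o cal) t001 hit.
rewrite a0 (max_idPl (ltW xD)) in g1.
have Dp : 0 < D by have := normr_ge0 (x - o); lra.
exists t1; split => // s t s0 st tt; have [t10 t1t0] := andP t1b.
have tb : 0 <= t <= 1 by apply/andP; split; lra.
have dt := bd_dist_ge0 G (al t).
have HHC : 60 * 32 * 32 * (H * H) * bd_dist G (al t) <= C * bd_dist G (al t).
  by apply: ler_wpM2r.
have HHd : bd_dist G (al t) <= H * H * bd_dist G (al t) by rewrite ler_peMl.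
(* The spread is D / 4, and 256 D is 32 * 32 times that: the origin of the factor 32 * 32 in the
   bound on [C]. *)
have far : `|al s - x| <= 256 * D.
  have := ler_triangle (al s) x o; rewrite (distrC o x).
  have : `|al s - o| <= `|al t1 - o| by apply: gle; apply/andP; split; lra.
  lra.
have [h|h|h] := good_path_local oG Gb H1 gp (spr Dp) tb.
- have := h s (ltac:(by rewrite s0)); lra.
- have pt : `|al t1 - al t| <= 120 * (H * H * bd_dist G (al t)).
    have := ler_triangle (al t1) (al t) y; rewrite (distrC y).
    have := h t1 (ltac:(by rewrite tt; lra)); have := h t (ltac:(by rewrite lexx; case/andP: tb)).
    lra.
  have dp : 127 * D <= bd_dist G (al t1).
    apply: bd_dist_ge => // b bb; have := ler_triangle (al t1) o b; have := bD b bb; lra.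
  have := bd_dist_lip (al t1) (al t) Gb; lra.
- lra.
Qed.

(** The polygon from p = [al t1] to q = [al t2] is counted towards x. At its point z all earlier
    points and x lie within 64|z - o| of o, and |z - o| <= 2d(z), which gives 256. This needs |p -
    o| <= |q - o|. *)
Lemma dchain_bounded (M C D : R) o x y al (t1 t2 : R) : 256 <= C -> 0 <= D ->
  cont_on 0 1 al -> al 0 = x -> al 1 = y -> (forall t, 0 <= t <= 1 -> G (al t)) ->
  bd G o -> (forall b, bd G b -> `|b - o| <= D) ->
  0 <= t1 <= 1 -> 0 <= t2 <= 1 -> 128 * D <= `|al t1 - o| -> `|al t1 - o| <= `|al t2 - o| ->
  (forall s, 0 <= s <= t1 -> `|al s - o| <= `|al t1 - o|) ->
  (forall s, t2 <= s <= 1 -> `|al s - o| <= `|al t2 - o|) ->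
  2 * `|al t2 - o| <= M * `|x - y| ->
  (forall s t, 0 <= s -> s <= t -> t <= t1 ->
      `|al s - x| <= C * bd_dist G (al t)) ->
  (forall s t, t2 <= t -> t <= s -> s <= 1 ->
      `|al s - y| <= C * bd_dist G (al t)) ->
  dchain G M C x y.
Proof.
move=> C256 D0 cal a0 a1 aG bo bD t1b t2b pD pq le1 le2 qr c1 c2.
have [t10 t11] := andP t1b; have [t20 t21] := andP t2b.
set p := al t1 in pD pq le1; set q := al t2 in pq le2 qr.
have Gp : G p by exact: aG.
have p0 : 0 < `|p - o|.
  by rewrite normr_gt0 subr_eq0; apply/eqP => e; case: bo => _; rewrite -e.
have sub1 : cont_on 0 t1 al by apply: cont_on_sub cal.
have sub2 : cont_on t2 1 al by apply: cont_on_sub cal.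
have G1 t : 0 <= t <= t1 -> G (al t) by move=> /andP[? ?]; apply: aG; apply/andP; split; lra.
have G2 t : t2 <= t <= 1 -> G (al t) by move=> /andP[? ?]; apply: aG; apply/andP; split; lra.
have [ta [pta lta sta]] := fine_chain oG Gb t10 sub1 G1.
have [tb [ptb ltb stb]] := fine_chain oG Gb t21 sub2 G2.
have [T [pT lT pwT bT]] := turning d2 oG Gb D0 bD Gp p0 pq pD.
have xo : `|x - o| <= `|p - o| by rewrite -a0; apply: le1; rewrite lexx.
have A_o z : z \in x :: map al ta -> `|z - o| <= `|p - o|.
  by rewrite -{1}a0;
    apply: (map_time_in (P := fun z => `|z - o| <= `|p - o|) pta lta) => t tt; apply: le1.
have B_o z : z \in al t2 :: map al tb -> `|z - o| <= `|q - o|.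
  by apply: (map_time_in (P := fun z => `|z - o| <= `|q - o|) ptb ltb) => t tt; apply: le2.
have turn_d w z : `|w - o| <= 64 * `|z - o| -> z \in p :: T -> `|w - x| <= C * bd_dist G z.
  move=> wz /bT[z1 z2].
  have dz : `|z - o| <= 2 * bd_dist G z.
    suff : `|z - o| / 2 <= bd_dist G z by lra.
    apply: bd_dist_ge => // b bb; have := ler_triangle z o b; have := bD b bb; lra.
  have := ler_triangle w x o; rewrite (distrC o x).
  have : 256 * bd_dist G z <= C * bd_dist G z by rewrite ler_wpM2r ?bd_dist_ge0.
  lra.
have memT z : z \in T -> z \in p :: T by move=> zT; rewrite inE zT orbT.
have memB z : z \in map al tb -> z \in al t2 :: map al tb by move=> zB; rewrite inE zB orbT.
have lA : last x (map al ta) = p by rewrite -a0 last_map lta.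
apply: (@dchain_lists _ _ G _ _ x y (map al ta ++ T) (map al tb)).
- by rewrite -catA !cat_path lA lT -{1}a0 sta pT stb.
- by rewrite !last_cat lA lT last_map ltb.
- move=> z zin.
  have zo : `|z - o| <= `|q - o|.
    move: zin; rewrite -cat_cons mem_cat -cat_cons mem_cat -orbA => /or3P[/A_o|zT|zB];
      first by lra.
      by have [] := bT z (memT z zT).
    exact: B_o (memB z zB).
  have := ler_triangle z x o; rewrite (distrC o x); lra.
- rewrite -cat_cons pairwise_cat; apply/and3P; split.
  + apply/allrelP => w z wA zT; apply: turn_d; last exact: memT.
    by have := A_o w wA; have [] := bT z (memT z zT); lra.
  + rewrite -{2}a0; apply: (pairwise_map_time pta lta) => s t s0 st tt; exact: c1.
  + move: pwT; rewrite pairwise_cons => /andP[_]; move=> pwT.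
    apply: (sub_in_pairwise (P := [in T])) pwT; last by apply/allP.
    by move=> w z wT zT wz; apply: turn_d => //; exact: memT.
- move=> z; rewrite -cat_cons mem_cat -{1}a0 => /orP[|zT].
    apply: (map_time_in (P := fun z => `|z - x| <= C * bd_dist G z) pta lta) => t /andP[t0 tt].
    exact: c1.
  apply: turn_d; last exact: memT.
  have := normr_ge0 (z - o); lra.
- have : pairwise (fun z w => `|w - y| <= C * bd_dist G z) (al t2 :: map al tb).
    by apply: (pairwise_map_time ptb ltb) => s t s0 st tt; exact: c2.
  by rewrite pairwise_cons => /andP[].
- move=> z zB; have := memB z zB.
  apply: (map_time_in (P := fun z => `|z - y| <= C * bd_dist G z) ptb ltb) => t /andP[t0 tt].
  exact: c2.
Qed.

(** [half_path] is applied from both ends. If the radius at the y end is the smaller one, the chain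
    is built from y to x and reversed, whence [M + 1]. *)
Lemma dchain_hit (H M C D : R) o x y al (t0 : R) : 1 <= H -> 60 * 32 * 32 * (H * H) <= C ->
  256 <= C -> M + 1 <= C -> good_path G H x y al -> 0 <= D -> bd G o ->
  (forall b, bd G b -> `|b - o| <= D) -> (0 < D -> bd_spread G (D / 4)) ->
  0 <= t0 <= 1 -> 128 * D <= `|al t0 - o| ->
  2 * Num.max (128 * D) `|x - o| <= M * `|x - y| ->
  2 * Num.max (128 * D) `|y - o| <= M * `|x - y| -> dchain G C C x y.
Proof.
move=> H1 hC C1 MC gp D0 bo bD spr t0b hit xM yM.
have [cal a0 a1 aG _] := gp; have gp' := good_path_rev gp; have [cal' a0' a1' aG' _] := gp'.
have flip (t : R) : 0 <= t <= 1 -> 0 <= 1 - t <= 1 by move=> /andP[? ?];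
  rewrite subr_ge0 gerBl; apply/andP.
have t0b' := flip _ t0b.
have hit' : 128 * D <= `|al (1 - (1 - t0)) - o| by rewrite subKr.
have [t1 [/andP[t10 t1t0] n1 m1 c1]] := half_path H1 hC gp D0 bD spr t0b hit.
have [t2 [/andP[t20 t2t0] n2 m2 c2]] := half_path H1 hC gp' D0 bD spr t0b' hit'.
rewrite /= in n2 m2 c2.
have t1b : 0 <= t1 <= 1 by rewrite t10 (le_trans t1t0)//; case/andP: t0b.
have t2b : 0 <= t2 <= 1 by rewrite t20 (le_trans t2t0)//; case/andP: t0b'.
have h1 : 128 * D <= `|al t1 - o| by rewrite n1 le_max lexx.
have h2 : 128 * D <= `|al (1 - t2) - o| by rewrite n2 le_max lexx.
rewrite -n1 in xM; rewrite -n2 in yM.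
clear hC spr hit hit' n1 n2.
have [pq|/ltW qp] := leP `|al t1 - o| `|al (1 - t2) - o|.
  apply: (dchain_weaken (M := M)); first by apply: le_trans MC; rewrite lerDl.
  apply: (dchain_bounded (t1 := t1) (t2 := 1 - t2) C1 D0 cal a0 a1 aG bo bD) => //.
  - exact: flip.
  - move=> s /andP[s0 s1]; rewrite -[s](subKr 1); apply: m2.
    by rewrite subr_ge0 s1 lerBlDl -lerBlDr.
  - move=> s t t20' ts s1; rewrite -[s](subKr 1) -[t](subKr 1).
    by apply: c2; rewrite ?subr_ge0 ?lerD2l ?lerN2// lerBlDl -lerBlDr.
apply: (dchain_weaken (M := M + 1)) => //; apply: dchain_rev.
apply: (dchain_bounded (t1 := t2) (t2 := 1 - t1) C1 D0 cal' a0' a1' aG' bo bD) => //.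
- exact: flip.
- by rewrite subKr.
- move=> s /andP[s0 s1]; rewrite subKr; apply: m1.
  by rewrite subr_ge0 s1 lerBlDl -lerBlDr.
- by rewrite subKr (distrC y).
- move=> s t t20' ts s1; apply: c1; first by rewrite subr_ge0.
    by rewrite lerD2l lerN2.
  by rewrite lerBlDl -lerBlDr.
Qed.

Lemma dchain_good_path (H C : R) x y al : 1 <= H -> 60 * 32 * 32 * (H * H) <= C ->
  good_path G H x y al -> x != y -> dchain G C C x y.
Proof.
move=> H1 hC gp xy; have [cal a0 a1 aG acr] := gp.
have Gx : G x by rewrite -a0; apply: aG; rewrite lexx ler01.
have Gy : G y by rewrite -a1; apply: aG; rewrite lexx ler01.
have dx := bd_dist_gt0 oG Gb Gx; have dy := bd_dist_gt0 oG Gb Gy.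
have HH : H <= H * H by rewrite ler_peMl//; lra.
set r := `|x - y|.
have r0 : 0 < r by rewrite normr_gt0 subr_eq0.
have C10 : 100 * 100 * H <= C by lra.
have C1 : 256 <= C by lra.
have C0 : 0 <= C by lra.
have dlx := bd_dist_lip x y Gb; have dly := bd_dist_lip y x Gb.
rewrite (distrC y x) -/r in dly; rewrite -/r in dlx.
have Hr : r <= H * r by rewrite ler_peMl// ltW.
(* Nearby points form a single step; afterwards both boundary distances are at most 5r. *)
have [close|] := leP (4 * r) (bd_dist G x).
  exists 1%N, (fun i => if i is 0%N then x else y); split.
  - by split => // -[|//] _; apply/andP; rewrite -/r; split; lra.
  - case=> [|i] _; rewrite ?subrr ?normr0; first exact: mulr_ge0.
    by rewrite distrC -/r ler_peMl//; lra.
  - move=> i _; left => j ji.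
    have [jx|jy] : (if j is 0%N then x else y) = x \/ (i != 0%N) && (j != 0%N).
      by case: j ji => [|j]; [left|case: i => //; right].
      rewrite jx subrr normr0; apply: mulr_ge0 => //; exact: bd_dist_ge0.
    case: i j jy {ji} => [|i] [|j] // _; rewrite distrC -/r.
    have : 1 * bd_dist G y <= C * bd_dist G y by rewrite ler_pM2r//; lra.
    lra.
move=> dxr; have dyr : bd_dist G y < 5 * r by lra.
have [ o bo xo] := bd_dist_near Gb dx.
have xo8 : `|x - o| <= 8 * r by lra.
have yo9 : `|y - o| <= 9 * r.
  by have := ler_triangle y o x; rewrite (distrC y x) -/r; lra.
(* Both endpoints are within 9r of o, and 36 = 4 * 9: with a boundary point b this far away, the
   three-point inequality for o and b keeps the whole path within 36Hr of o, hence within 44Hr of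
   x. *)
have [[b bb bo36]|small] := pselect (exists2 b, bd G b & 36 * H * r <= `|b - o|).
  apply: (dchain_weaken (M := 44 * H)); first by lra.
  have ox := xo8; rewrite distrC in ox.
  have spr : bd_spread G (18 * H * r).
    split; first by rewrite !mulr_gt0//; lra.
    move=> a ba; have [h|h] := leP (18 * H * r) `|b - a|; first by exists b.
    exists o => //; have := ler_triangle b o a; rewrite (distrC a o); lra.
  have close : forall t, 0 <= t <= 1 -> `|al t - x| <= 44 * H * r.
    move=> t t01; set z := al t.
    have : `|o - z| <= 36 * H * r.
      rewrite leNgt; apply/negP => zz.
      have t1 : t <= 1 by case/andP: t01.
      have t0 : 0 <= t by case/andP: t01.
      have cr := (acr t 1 t0 t1 (lexx _)).1; rewrite a1 -/z in cr.
      have key u : `|o - u| <= 9 * r -> `|o - z| * `|b - u| <= H * `|o - u| * `|b - z| -> False.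
        move=> ou; apply/negP; rewrite -ltNge.
        have bu : `|b - o| / 2 <= `|b - u|.
          have := ler_triangle b o u; rewrite (distrC u) (distrC b o) in bo36 *; lra.
        have bz : `|b - z| <= `|b - o| + `|o - z| by exact: ler_triangle.
        have H0 : 0 < H by lra.
        set B := `|b - o| in bo36 bu bz *; set Z := `|o - z| in zz bz *.
        apply: (@le_lt_trans _ _ (H * (9 * r) * (B + Z))).
          rewrite -[leLHS]mulrA -[leRHS]mulrA ler_pM2l//; apply: ler_pM => //; exact: normr_ge0.
        apply: (@lt_le_trans _ _ (Z * (B / 2))); last by rewrite ler_wpM2l// /Z.
        have rB : 36 * H * r <= B by exact: bo36.
        have B0 : 0 < B by apply: lt_le_trans rB; rewrite !mulr_gt0//; lra.
        have : 36 * H * r * B < Z * B by rewrite ltr_pM2r.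
        have : 36 * H * r * Z <= B * Z by rewrite ler_wpM2r// /Z.
        lra.
      case: (cr o b bo bb); apply: key; first by lra.
      by rewrite distrC.
    have := ler_triangle z x o; rewrite (distrC z o); lra.
  have [||n [v [ch tot loc]]] := dchain_path (K := 3) (M := 44 * H) oG Gb H1 _ gp spr _.
  - by lra.
  - by move=> t tt; have := close t tt; split => //; lra.
  exists n, v; split => // i ilt.
  have le3 : 60 * 3 * (H * H) * bd_dist G (v i) <= C * bd_dist G (v i).
    by apply: ler_wpM2r; [exact: bd_dist_ge0|lra].
  by case: (loc i ilt) => h; [left|right] => j ji; apply: le_trans (h j ji) le3.
have bD0 b : bd G b -> `|b - o| <= 36 * H * r.
  by move=> bb; rewrite leNgt; apply/negP => lt; apply: small; exists b => //; exact: ltW.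
pose S := [set `|b - o| | b in bd G].
have hS : has_sup S.
  split; first by exists `|o - o|, o.
  by exists (36 * H * r) => _ [b bb <-]; exact: bD0.
pose D := sup S.
have bD b : bd G b -> `|b - o| <= D by move=> bb; apply: sup_upper_bound => //; exists b.
have D0 : 0 <= D by have := bD o bo; rewrite subrr normr0.
have DH : D <= 36 * H * r.
  by apply: ge_sup => [|_ [b bb <-]]; [exists `|o - o|, o|exact: bD0].
(* [D] is the exact radius of the boundary about o, so some b has |b - o| > D / 2; every boundary
   point is at least D / 4 away from b or from o. *)
have spr : 0 < D -> bd_spread G (D / 4).
  move=> Dp; split; first by rewrite divr_gt0.
  have [_ [b bb <-] Db] := sup_adherent (ltac:(by rewrite divr_gt0) : 0 < D / 2) hS.
  rewrite -/D in Db; move=> a ba.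
  have [h|h] := leP (D / 4) `|b - a|; first by exists b.
  exists o => //; have := ler_triangle b o a; rewrite (distrC o); lra.
have [[t0 t0b hit]|stay] := pselect (exists2 t, 0 <= t <= 1 & 128 * D <= `|al t - o|); last first.
  have far t : 0 <= t <= 1 -> `|al t - o| < 128 * D.
    by move=> tt; rewrite ltNge; apply/negP => h; apply: stay; exists t.
  have Dp : 0 < D.
    have := far 0 (ltac:(by rewrite lexx ler01)); have := normr_ge0 (al 0 - o); lra.
  have far0 := far 0 (ltac:(by rewrite lexx ler01)); rewrite a0 in far0.
  (* The path stays within 256 D of x. In units of D / 4 this is 32 * 32, and D <= 36Hr makes it 96
     * 96 * H * r. *)
  have K1 : 1 <= 32 * 32 :> R by lra.
  have [|n [v [ch tot loc]]] := dchain_path (M := 96 * 96 * H) oG Gb H1 K1 gp (spr Dp) _.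
    move=> t tt.
    by have := far t tt; have := ler_triangle (al t) x o; rewrite (distrC o x) -/r; split; lra.
  exists n, v; split => // i ilt.
    by apply: le_trans (tot i ilt) _; apply: ler_wpM2r => //; lra.
  have leC : 60 * (32 * 32) * (H * H) * bd_dist G (v i) <= C * bd_dist G (v i).
    by apply: ler_wpM2r; [exact: bd_dist_ge0|rewrite (mulrA 60)].
  by case: (loc i ilt) => h; [left|right] => j ji; apply: le_trans (h j ji) leC.
have r8 : 0 <= H * r by lra.
have D128 : 128 * D <= 48 * 96 * H * r by lra.
apply: (dchain_hit (M := 96 * 96 * H) H1 hC C1 _ gp D0 bo bD spr t0b hit).
- by lra.
- by rewrite -/r -ler_pdivlMl// ge_max; apply/andP; split; lra.
- by rewrite -/r -ler_pdivlMl// ge_max; apply/andP; split; lra.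
Qed.

End Bounded.

(** * Arc length and quasihyperbolic distance *)

Section LogIntegral.
Context {R : realType}.

(** A nonnegative integral is a supremum over simple functions below the integrand, so comparing
    these suprema works for arbitrary functions, among them the integrand of [line_integral], which
    is defined by choice. *)
Lemma ge0_le_integral_subset (D D' : set R) (f g : R -> \bar R) : D `<=` D' ->
  (forall x, D x -> 0 <= f x)%E -> (forall x, D' x -> 0 <= g x)%E ->
  (forall x, D x -> f x <= g x)%E ->
  (\int[lebesgue_measure]_(x in D) f x <= \int[lebesgue_measure]_(x in D') g x)%E.
Proof.
move=> DD f0 g0 fg; rewrite !ge0_integralE//.
apply: le_ereal_sup => _ [h hf <-]; exists h => // x.
apply: le_trans (hf x) _; rewrite !patchE.
case: ifPn => [|_].
  by rewrite inE => Dx; rewrite ifT ?inE; [exact: fg|exact: DD].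
by case: ifPn => // /set_mem/g0.
Qed.

Lemma integral_inv_sub (A m : R) : 0 < m -> m < A ->
  (\int[lebesgue_measure]_(s in `[0%R, m]) ((A - s)^-1)%:E = (ln (A / (A - m)))%:E)%E.
Proof.
move=> m0 mA; pose F (s : R) := - ln (A - s).
have dF (s : R) : s < A -> is_derive s 1 F (A - s)^-1.
  move=> sA; have H : 0 < A - s by rewrite subr_gt0.
  have := is_derive1_ln H => H1.
  rewrite /F; apply: is_derive_eq.
  by rewrite add0r mul1r mulrN1 opprK.
have cF (s : R) : s < A -> {for s, continuous F}.
  move=> sA; have [df _] := dF s sA.
  by apply: differentiable_continuous; exact/derivable1_diffP.
rewrite (@continuous_FTC2 R (fun s => (A - s)^-1) F 0 m m0).
- rewrite /F subr0 -EFinB opprK addrC -ln_div// ?posrE ?subr_gt0//.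
  exact: lt_trans mA.
- apply/subspace_continuousP => s; rewrite /= in_itv /= => /andP[s0 sm].
  apply: cvg_within_filter; apply: cvgV; first by rewrite subr_eq0 gt_eqF// (le_lt_trans sm).
  by apply: cvgB; [exact: cvg_cst|exact: cvg_id].
- split.
  + by move=> s; rewrite in_itv /= => /andP[_ sm]; have [] := dF s (lt_trans sm mA).
  + apply: cvg_at_right_filter; apply: cF; exact: lt_trans mA.
  + apply: cvg_at_left_filter; exact: cF.
- by move=> s; rewrite in_itv /= => /andP[_ sm]; rewrite derive1E;
  have [_ ->] := dF s (lt_trans sm mA).
Qed.

End LogIntegral.

Section ArcLength.
Context {R : realType} {E : normedModType R}.
Variable g : R -> E.
Hypotheses (cg : cont_on 0 1 g) (rect : rectifiable g).

Lemma rectifiable_sub (a b : R) : 0 <= a -> a <= b -> b <= 1 ->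
  exists2 l : R, 0 <= l & curve_length a b g = l%:E.
Proof.
move=> a0 ab b1; have H0 := curve_length_ge0 g ab.
have H1 : (curve_length a b g <= curve_length 0 1 g)%E.
  apply: le_trans (curve_length_superadd g (le_trans a0 ab) b1).
  apply: le_trans (leeDl _ (curve_length_ge0 g b1)).
  apply: le_trans (curve_length_superadd g a0 ab).
  by apply: leeDr; exact: curve_length_ge0.
have := le_lt_trans H1 rect; move: H0.
by case: (curve_length a b g) => [l| |] // l0 _; exists l.
Qed.

Definition len (a b : R) := fine (curve_length a b g).

Lemma lenE (a b : R) : 0 <= a -> a <= b -> b <= 1 -> curve_length a b g = (len a b)%:E.
Proof. by move=> a0 ab b1; rewrite /len; have [l _ ->] := rectifiable_sub a0 ab b1. Qed.

Lemma len_ge0 (a b : R) : a <= b -> 0 <= len a b.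
Proof. by move=> ab; rewrite fine_ge0// curve_length_ge0. Qed.

Lemma len_dist (a b : R) : 0 <= a -> a <= b -> b <= 1 -> `|g b - g a| <= len a b.
Proof. by move=> a0 ab b1; rewrite -lee_fin -lenE//; exact: curve_length_ge_dist. Qed.

Lemma len_add (a b c : R) : 0 <= a -> a <= c -> c <= b -> b <= 1 -> len a b = len a c + len c b.
Proof.
move=> a0 ac cb b1.
have := curve_length_subadd g ac cb; have := curve_length_superadd g ac cb.
rewrite !lenE ?(le_trans a0)//; try lra.
by rewrite -EFinD !lee_fin => h1 h2; apply/eqP; rewrite eq_le h1 h2.
Qed.

Lemma len_approx (a b e : R) : 0 <= a -> a <= b -> b <= 1 -> 0 < e ->
  exists s, [/\ path <%R a s, last a s = b & len a b - e < plen (g a) (map g s)].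
Proof.
move=> a0 ab b1 e0; apply: contrapT => H.
have : (curve_length a b g <= (len a b - e)%:E)%E.
  apply: curve_length_le => s ps ls; rewrite leNgt; apply/negP => lt.
  by apply: H; exists s.
by rewrite lenE// lee_fin; lra.
Qed.

(** Take a partition of [t, 1] that nearly attains the length. Moving its first point from t to a
    nearby u changes the polygon little by continuity of [g], so [len u 1] is almost [len t 1]. *)
Lemma len_right_small (t e : R) : 0 <= t -> t < 1 -> 0 < e ->
  exists2 del, 0 < del & forall u, t <= u -> u <= 1 -> u - t < del -> len t u < e.
Proof.
move=> t0 t1 e0; have e20 : 0 < e / 2 by rewrite divr_gt0.
have [[|h s] [/= ps ls lt]] := len_approx t0 (ltW t1) (lexx _) e20; first by lra.
have /andP[th phs] := ps.
have tb : 0 <= t <= 1 by rewrite t0 ltW.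
have h1 : h <= 1.
  rewrite -ls; have := mem_last h s; rewrite inE => /predU1P[->//|].
  by move/(order_path_min lt_trans)/allP: phs => /[apply]/ltW.
have [del d0 H] := cg tb e20.
exists (Num.min del (h - t)); first by rewrite lt_min d0 subr_gt0.
move=> u tu u1; rewrite lt_min => /andP[ud uh].
have gu : `|g u - g t| < e / 2.
  by apply: H; [apply/andP; split; lra|rewrite ger0_norm ?subr_ge0].
have : plen (g u) (map g (h :: s)) <= len u 1.
  rewrite -lee_fin -lenE//; last by lra.
  apply: plen_le_curve_length => //=; rewrite phs andbT; lra.
have := len_add t0 tu u1 (lexx _) => /=.
have := ler_triangle (g h) (g t) (g u); lra.
Qed.

Lemma len_left_small (t e : R) : 0 < t -> t <= 1 -> 0 < e ->
  exists2 del, 0 < del & forall u, 0 <= u -> u <= t -> t - u < del -> len u t < e.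
Proof.
move=> t0 t1 e0; have e20 : 0 < e / 2 by rewrite divr_gt0.
have [s] := len_approx (lexx 0) (ltW t0) t1 e20.
case: (lastP s) => [[/= _ e1 _]|{}s h]; first by lra.
rewrite rcons_path last_rcons map_rcons -cats1 plen_cat last_map /= addr0 => -[/andP[ps lt] ht H].
rewrite {h}ht in lt H *; set k := last 0 s in lt H.
have k0 : 0 <= k.
  rewrite /k; have := mem_last 0 s; rewrite inE => /predU1P[->//|].
  by move/(order_path_min lt_trans)/allP: ps => /[apply]/ltW.
have tb : 0 <= t <= 1 by rewrite t1 ltW.
have [del d0 Hd] := cg tb e20.
exists (Num.min del (t - k)); first by rewrite lt_min d0 subr_gt0.
move=> u u0 ut; rewrite lt_min => /andP[ud uk].
have gu : `|g u - g t| < e / 2.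
  by apply: Hd; [apply/andP; split; lra|rewrite distrC ger0_norm ?subr_ge0].
have H1 : plen (g 0) (map g s) <= len 0 k.
  by rewrite -lee_fin -lenE//; [exact: plen_le_curve_length|lra].
have ku : k <= u by lra.
have H2 := len_dist k0 ku (le_trans ut t1).
have := len_add (lexx 0) k0 ku (le_trans ut t1).
have := len_add (lexx 0) u0 ut t1.
have := ler_triangle (g t) (g k) (g u); rewrite (distrC (g t) (g u)); lra.
Qed.

Lemma len_cont : cont_on 0 1 (len 0).
Proof.
move=> t /andP[t0 t1] e e0.
have [dr dr0 Hr] : exists2 del, 0 < del & forall u, t <= u -> u <= 1 -> u - t < del ->
  len t u < e.
  have [lt|] := ltP t 1; first exact: len_right_small.
  move=> h; exists 1 => // u tu u1 _; have -> : u = t by lra.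
  by have := len_add t0 (lexx t) (lexx t) t1; lra.
have [dl dl0 Hl] : exists2 del, 0 < del & forall u, 0 <= u -> u <= t -> t - u < del ->
  len u t < e.
  have [lt|] := ltP 0 t; first exact: len_left_small.
  move=> h; exists 1 => // u u0 ut _; have -> : u = t by lra.
  by have := len_add t0 (lexx t) (lexx t) t1; lra.
exists (Num.min dr dl); first by rewrite lt_min dr0.
move=> s /andP[s0 s1]; rewrite lt_min => /andP[sr sl].
have [st|ts] := leP s t.
  rewrite distrC (len_add (lexx 0) s0 st t1) addrAC subrr add0r ger0_norm ?len_ge0//.
  by apply: Hl => //; apply: le_lt_trans sl; rewrite distrC; exact: ler_norm.
rewrite (len_add (lexx 0) t0 (ltW ts) s1) addrAC subrr add0r ger0_norm ?len_ge0 ?ltW//.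
by apply: Hr => //; [exact: ltW|apply: le_lt_trans sr; exact: ler_norm].
Qed.

(** By continuity the length takes every intermediate value, so [xget] makes a genuine choice and
    does not return its default. *)
Lemma arclength_paramP (s : R) : 0 <= s <= len 0 1 ->
  exists t, [/\ 0 <= t <= 1, len 0 t = s & arclength_param g s = g t].
Proof.
move=> /andP[s0 s1].
have len00 : len 0 0 = 0 by have := len_add (lexx 0) (lexx 0) (lexx 0) ler01; lra.
have [t [t01 tE _]] := first_hit len_cont (ltac:(by rewrite ler01 lexx) : 0 <= 1 <= 1) s1.
rewrite len00 (max_idPl s0) in tE.
rewrite /arclength_param; set P := [set _ | _].
have Pt : P t by split => //; case/andP: t01 => ? ?; rewrite lenE// tE.
have [u01 uE] := xgetPex 0 (ex_intro P t Pt).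
exists (xget 0 P); split => //.
by have := uE; case/andP: u01 => u0 u1; rewrite lenE// => -[].
Qed.

Lemma arclength_param_dist (s t : R) : 0 <= s <= len 0 1 -> 0 <= t <= 1 ->
  `|arclength_param g s - g t| <= `|s - len 0 t|.
Proof.
move=> s01 /andP[t0 t1]; have [u [/andP[u0 u1] <- ->]] := arclength_paramP s01.
have [ut|tu] := leP u t.
  rewrite distrC (distrC (len 0 u)) (len_add (lexx 0) u0 ut t1) addrAC subrr add0r.
  by rewrite (ger0_norm (len_ge0 ut)); exact: len_dist.
rewrite (len_add (lexx 0) t0 (ltW tu) u1) addrAC subrr add0r.
by rewrite (ger0_norm (len_ge0 (ltW tu))); exact: len_dist (ltW tu) u1.
Qed.

(** With m = [len 0 t] and d the boundary distance of [g t], the point at length s <= m has boundary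
    distance at most d + m - s. Integrating the reciprocal over [0, m] gives the logarithm. *)
Lemma line_integral_ge (G : set E) (t : R) : open G -> bd G !=set0 -> trace g 0 1 `<=` G ->
  0 <= t <= 1 ->
  ((ln (1 + len 0 t / bd_dist G (g t)))%:E <=
    line_integral (fun z => ((bd_dist G z)^-1)%R) g)%E.
Proof.
move=> oG Gb gG t01; have /andP[t0 t1] := t01.
have Gt : G (g t) by apply: gG; exists t => //=; rewrite in_itv.
have dt := bd_dist_gt0 oG Gb Gt; set d := bd_dist G (g t) in dt *.
set m := len 0 t; have m0 : 0 <= m by exact: len_ge0.
have mL : m <= len 0 1.
  by rewrite (len_add (lexx 0) t0 t1 (lexx 1)) lerDl len_ge0.
rewrite /line_integral -/(len 0 1).
have intpos (s : R) : `[0, len 0 1]%classic s ->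
    (0 <= ((bd_dist G (arclength_param g s))^-1)%:E)%E.
  by move=> _; rewrite lee_fin invr_ge0 bd_dist_ge0.
move: m0; rewrite le_eqVlt => /predU1P[<-|m0].
  by rewrite mul0r addr0 ln1; exact: integral_ge0.
have -> : 1 + m / d = (d + m) / (d + m - m).
  by rewrite addrK mulrDl divff ?gt_eqF.
rewrite -integral_inv_sub//; last by rewrite ltrDr.
apply: ge0_le_integral_subset => //.
- by move=> s /=; rewrite !in_itv /= => /andP[-> sm] /=; lra.
- by move=> s /=; rewrite in_itv /= => /andP[s0 sm]; rewrite lee_fin invr_ge0; lra.
- move=> s /=; rewrite in_itv /= => /andP[s0 sm].
  have sL : 0 <= s <= len 0 1 by rewrite s0 /=; lra.
  have [u [u01 _ gu]] := arclength_paramP sL.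
  have Gu : G (arclength_param g s) by rewrite gu; apply: gG; exists u => //=; rewrite in_itv.
  rewrite lee_fin lef_pV2 ?posrE ?(bd_dist_gt0 oG Gb Gu)//; last by lra.
  have := bd_dist_lip (arclength_param g s) (g t) Gb.
  have := arclength_param_dist sL t01; rewrite -/m -/d (distrC s) ger0_norm ?subr_ge0//; lra.
Qed.

End ArcLength.

(** The summand 1 allows for an infimum that is not attained. [line_integral_ge] at each time bounds
    the length travelled by a multiple of the boundary distance. *)
Lemma qh_curve {R : realType} {E : normedModType R} (G : set E) (p q : E) (K : R) :
  open G -> bd G !=set0 -> (qh_dist G p q <= K%:E)%E ->
  exists g, [/\ cont_on 0 1 g, rectifiable g, g 0 = p, g 1 = q &
    forall t, 0 <= t <= 1 -> G (g t) /\ len g 0 t <= expR (K + 1) * bd_dist G (g t)].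
Proof.
move=> oG Gb qK.
have : (qh_dist G p q < (K + 1)%:E)%E by apply: le_lt_trans qK _; rewrite lte_fin ltrDl.
move/ereal_inf_lt => [_ [g [[cg g0 g1 gG] rg] <-] lt].
have {}cg : cont_on 0 1 g by exact/within_cont_on.
exists g; split => // t t01.
have Gt : G (g t) by apply: gG; exists t => //=; rewrite in_itv.
split => //; have dt := bd_dist_gt0 oG Gb Gt.
have l0 : 0 <= len g 0 t by apply: len_ge0; case/andP: t01.
have := le_lt_trans (line_integral_ge cg rg oG Gb gG t01) lt.
rewrite lte_fin => H.
have pos : 0 < 1 + len g 0 t / bd_dist G (g t) by rewrite ltr_pwDl// divr_ge0// ltW.
have : 1 + len g 0 t / bd_dist G (g t) <= expR (K + 1).
  by rewrite -(lnK (pos : _ \is Num.pos)) ler_expR ltW.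
rewrite -ler_pdivrMr//; lra.
Qed.

(** * Natural domains *)

Section Natural.
Context {R : realType} {E : normedModType R}.
Variables (G : set E) (psi : R -> R).
Hypotheses (oG : open G) (Gb : bd G !=set0).
Hypotheses (psi_inc : increasing_nneg psi) (nat_G : natural_domain psi G).
Implicit Types (x y z p q : E) (g gam : R -> E).

(** [l] is the length travelled before reaching [x]. For l = 0 this is the length condition at every
    vertex, measured from the start. *)
Fixpoint cone (K l : R) x (s : seq E) : Prop :=
  l <= K * bd_dist G x /\ (if s is y :: s' then cone K (l + `|y - x|) y s' else True).

Lemma cone_cat K l x s1 s2 : cone K l x s1 -> cone K (l + plen x s1) (last x s1) s2 ->
  cone K l x (s1 ++ s2).
Proof.
elim: s1 l x => [|y s IH] l x /=; first by rewrite addr0.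
by move=> [lx H1]; rewrite addrA => H2; split => //; exact: IH.
Qed.

Lemma cone_nth K l x s i y0 : cone K l x s -> (i <= size s)%N ->
  l + plen x (take i s) <= K * bd_dist G (nth y0 (x :: s) i).
Proof.
elim: s l x i => [|y s IH] l x [|i] //=; rewrite ?addr0; try by case.
by move=> [_ H]; rewrite ltnS addrA => /IH; exact.
Qed.

Lemma cone_curve K g (l0 : R) ts : cont_on 0 1 g -> rectifiable g ->
  (forall t, 0 <= t <= 1 -> l0 + len g 0 t <= K * bd_dist G (g t)) ->
  forall tau l, 0 <= tau -> path <%R tau ts -> last tau ts <= 1 -> l <= l0 + len g 0 tau ->
  cone K l (g tau) (map g ts) /\ plen (g tau) (map g ts) <= len g tau (last tau ts).
Proof.
move=> cg rg H; elim: ts => [tau l t0 _ t1 hl|t ts IH tau l t0].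
  split; last exact: len_ge0.
  by split => //; apply: le_trans hl _; apply: H; rewrite t0.
move=> /=/andP[tt pt] lt hl.
have tl : t <= last t ts.
  have := mem_last t ts; rewrite inE => /predU1P[->//|].
  by move/(order_path_min lt_trans)/allP: pt => /[apply]/ltW.
have t1 : t <= 1 := le_trans tl lt.
have d := len_dist rg t0 (ltW tt) t1.
have a := len_add rg (lexx 0) t0 (ltW tt) t1.
have a' := len_add rg t0 (ltW tt) tl lt.
have [|c1 c2] := IH t (l + `|g t - g tau|) (le_trans t0 (ltW tt)) pt lt; first by lra.
split; last by lra.
split => //; apply: le_trans hl _; apply: H; rewrite t0 /=; lra.
Qed.

(** Two points of the subarc are at most 4m apart and have boundary distance at least m / c; this is
    the origin of 4c. Naturality applies to the subarc as a connected set. *)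
Lemma qh_dist_subarc gam (c m : R) x (s t : R) : 1 <= c -> 0 < m -> 0 <= s -> s <= t -> t <= 1 ->
  cont_on 0 1 gam -> (forall u, 0 <= u <= 1 -> G (gam u)) ->
  (forall u, s <= u <= t -> `|gam u - x| <= 2 * m /\ m <= c * bd_dist G (gam u)) ->
  (qh_dist G (gam s) (gam t) <= (psi (4 * c))%:E)%E.
Proof.
move=> c1 m0 s0 st t1 cg gG bds; pose A := gam @` `[s, t].
have c0 : 0 < c by lra.
have Ap p : A p -> `|p - x| <= 2 * m /\ m <= c * bd_dist G p.
  by move=> [u + <-]; rewrite /= in_itv /=; exact: bds.
have rd p q : A p -> A q -> rel_dist G p q <= 4 * c.
  move=> /Ap[px dp] /Ap[qx dq]; rewrite /rel_dist.
  have mn : m <= c * Num.min (bd_dist G p) (bd_dist G q) by rewrite /Num.min; case: ifP.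
  have mp : 0 < Num.min (bd_dist G p) (bd_dist G q).
    by rewrite -(pmulr_rgt0 _ c0) (lt_le_trans m0).
  rewrite ler_pdivrMr//; have := ler_triangle p q x; rewrite (distrC x q); lra.
have As : A (gam s) by exists s => //=; rewrite in_itv /= lexx.
have At : A (gam t) by exists t => //=; rewrite in_itv /= lexx st.
have Ac : connected A.
  apply: connected_continuous_connected; first exact: segment_connected.
  by apply/within_cont_on; apply: cont_on_sub cg.
have AG : A `<=` G.
  by move=> _ [u + <-]; rewrite /= in_itv /= => /andP[su ut]; apply: gG;
    rewrite (le_trans s0 su) (le_trans ut).
have rdA : (rel_diam G A <= (4 * c)%:E)%E.
  by apply: ge_ereal_sup => _ [[p q] /= [Ap' Aq] <-]; rewrite lee_fin; exact: rd.
have rd0 : (0 <= rel_diam G A)%E.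
  apply: le_trans (_ : ((rel_dist G (gam s) (gam s))%:E <= _)%E).
    by rewrite lee_fin /rel_dist subrr normr0 mul0r.
  by apply: ereal_sup_ubound; exists (gam s, gam s).
have fin : (rel_diam G A < +oo)%E by apply: le_lt_trans rdA _; exact: ltry.
have := nat_G (ex_intro A _ As) Ac AG fin.
have : (qh_dist G (gam s) (gam t) <= qh_diam G A)%E.
  by apply: ereal_sup_ubound; exists (gam s, gam t).
move=> /le_trans h /h /le_trans; apply; rewrite lee_fin.
case: psi_inc => _; apply.
  by rewrite fine_ge0.
by rewrite -lee_fin fineK// ge0_fin_numE.
Qed.

Let N c := expR (psi (4 * c) + 1).

(* Induction on [i]: up to the first hit of the sphere of radius 2^i d(x) / 4 the
   induction hypothesis applies, and naturality handles the rest. *)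
Lemma half_chain gam (c ta : R) x : 1 <= c -> 0 <= ta <= 1 ->
  cont_on 0 1 gam -> gam 0 = x -> (forall u, 0 <= u <= 1 -> G (gam u)) ->
  (forall s t, 0 <= s -> s <= t -> t <= ta -> `|gam s - x| <= c * bd_dist G (gam t)) ->
  forall i t, 0 <= t <= ta ->
  (forall s, 0 <= s <= t -> `|gam s - x| <= 2 ^+ i * (bd_dist G x / 4)) ->
  exists s, [/\ path (step G) x s, last x s = gam t,
    plen x s <= 6 * N c * (2 ^+ i * (bd_dist G x / 4)) &
    cone (6 * N c * c * (N c + 1) + N c) 0 x s].
Proof.
move=> c1 /andP[ta0 ta1] cg g0 gG cn.
have Gx : G x by rewrite -g0; apply: gG; rewrite lexx ler01.
have dx := bd_dist_gt0 oG Gb Gx; set del := bd_dist G x / 4.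
have del0 : 0 < del by rewrite divr_gt0.
have N1 : 1 <= N c.
  have psi0 : 0 <= psi (4 * c) by case: psi_inc => h _; apply: h; lra.
  by rewrite /N -[X in X <= _]expR0 ler_expR; lra.
have [n nE] : exists n : R, n = N c by eexists.
rewrite -nE in N1 *; set K := 6 * n * c * (n + 1) + n.
have nc : 1 <= n * c by rewrite -[1]mulr1 ler_pM.
have ncn : 1 <= n * c * (n + 1) by rewrite -[1]mulr1 ler_pM//; lra.
have K1 : 2 <= K by rewrite /K; lra.
elim=> [|i IH] t /andP[t0 tta] bds.
  have tx : `|gam t - x| <= del.
    by have := bds t; rewrite expr0 mul1r; apply; rewrite t0 lexx.
  have dt : 3 * del <= bd_dist G (gam t).
    have := bd_dist_lip x (gam t) Gb; rewrite (distrC x) /del in tx *; lra.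
  exists [:: gam t]; rewrite /= andbT addr0 expr0 mul1r add0r; split => //.
  - by rewrite /step distrC; apply/andP; rewrite /del in dt tx; split; lra.
  - have : del <= n * del by rewrite ler_peMl// ltW.
    lra.
  - have Kd : 2 * bd_dist G (gam t) <= K * bd_dist G (gam t) by rewrite ler_wpM2r// bd_dist_ge0.
    split; first by rewrite mulr_ge0//; lra.
    by split => //; lra.
set m := 2 ^+ i * del; have m0 : 0 < m by rewrite mulr_gt0// exprn_gt0.
have delm : del <= m by apply: ler_peMl; [exact: ltW|rewrite exprn_ege1// ler1n].
have mS : 2 ^+ i.+1 * del = 2 * m by rewrite exprS -mulrA.
rewrite mS in bds *.
have [small|] := pselect (forall s, 0 <= s <= t -> `|gam s - x| <= m).
  have [|s [h1 h2 h3 h4]] := IH t _ small; first by rewrite t0.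
  exists s; split => //; apply: le_trans h3 _; rewrite -/m.
  have : 0 <= n * m by rewrite mulr_ge0//; lra.
  lra.
move=> /existsNP[s0 /not_implyP[/andP[s00 s0t] /negP]]; rewrite -ltNge => s0m.
have s01 : 0 <= s0 <= 1 by rewrite s00 /=; lra.
have [s [/andP[sp ss0] gs gle]] := first_hit (cont_on_dist x cg) s01 (ltW s0m).
rewrite g0 subrr normr0 (max_idPl (ltW m0)) in gs.
have st : s <= t := le_trans ss0 s0t.
have [||A [pA lA nA cA]] := IH s.
- by rewrite sp /=; lra.
- by move=> u u0; rewrite -/m -gs; exact: gle.
have t1 : t <= 1 := le_trans tta ta1.
have qh : (qh_dist G (gam s) (gam t) <= (psi (4 * c))%:E)%E.
  apply: (qh_dist_subarc (x := x) c1 m0) => // u /andP[su ut]; split.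
    by apply: bds; rewrite ut andbT; lra.
  by rewrite -gs; apply: cn => //; lra.
have [g [gc rg e0 e1 gcone]] := qh_curve oG Gb qh.
have {}gcone u : 0 <= u <= 1 -> G (g u) /\ len g 0 u <= n * bd_dist G (g u).
  by move=> /gcone; rewrite nE.
have [ts [pts lts sts]] := fine_chain oG Gb ler01 gc (fun u u01 => (gcone u u01).1).
(* m <= c d(gam s), and moving along [g] costs at most n d(g u). The length 6nm already used is thus
   at most 6nc(n + 1) d(g u); the extra n in [K] pays for the length of [g] itself. *)
have md u : 0 <= u <= 1 -> m <= c * (n + 1) * bd_dist G (g u).
  move=> u01; have [_ h] := gcone u u01; have /andP[u0 u1] := u01.
  have h1 : m <= c * bd_dist G (gam s) by rewrite -gs; apply: cn => //; lra.
  have h2 := len_dist rg (lexx 0) u0 u1; rewrite e0 in h2.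
  have h3 := bd_dist_lip (gam s) (g u) Gb; rewrite distrC in h3.
  apply: le_trans h1 _; rewrite -mulrA ler_pM2l; last by lra.
  lra.
have [cB nB] : cone K (plen x A) (g 0) (map g ts) /\ plen (g 0) (map g ts) <= len g 0 (last 0 ts).
  apply: (@cone_curve K g (6 * n * m)) => //; last 2 first.
  - by rewrite lts.
  - by have := len_ge0 g (lexx 0); rewrite -/m in nA; lra.
  move=> u u01; have [_ h] := gcone u u01; have := md u u01.
  have n6 : 0 <= 6 * n by lra.
  by move/(ler_wpM2l n6); rewrite /K; lra.
(* d(gam t) <= 2m + d(x) <= 6m. The sum 6nm + 6nm = 6n(2m) reproduces the bound at the doubled
   radius, so the induction closes. *)
have gt_ : len g 0 1 <= n * (6 * m).
  have [_ h] := gcone 1 (ltac:(by rewrite lexx ler01)); rewrite e1 in h.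
  apply: le_trans h _; rewrite ler_wpM2l//; first by lra.
  have := bds t (ltac:(by rewrite t0 lexx)); have := bd_dist_lip (gam t) x Gb.
  have : bd_dist G x = 4 * del by rewrite /del; lra.
  lra.
exists (A ++ map g ts); split.
- by rewrite cat_path pA lA -e0 sts.
- by rewrite last_cat lA -e0 last_map lts.
- rewrite plen_cat lA -e0; rewrite lts in nB; rewrite -/m in nA; lra.
- by apply: cone_cat => //; rewrite add0r lA -e0.
Qed.

Lemma doubling (del M : R) : 0 < del -> del <= M -> exists i, M <= 2 ^+ i * del <= 2 * M.
Proof.
move=> d0 dM.
have Md : 0 <= M / del by rewrite divr_ge0 ?ltW//; lra.
have [n nM] : exists n, M <= 2 ^+ n * del.
  exists (Num.bound (M / del)); rewrite -ler_pdivrMr//; apply/ltW.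
  apply: lt_le_trans (archi_boundP Md) _.
  by rewrite -natrX ler_nat ltnW// ltn_expl.
elim: n nM => [|n IH] nM.
  by exists 0%N; rewrite nM expr0 mul1r; lra.
have [/IH//|lt] := leP M (2 ^+ n * del).
by exists n.+1; rewrite nM exprS -mulrA /=; lra.
Qed.

Lemma half_chain_fun gam (c ta M : R) x : 1 <= c -> 0 <= ta <= 1 ->
  cont_on 0 1 gam -> gam 0 = x -> (forall u, 0 <= u <= 1 -> G (gam u)) ->
  (forall s t, 0 <= s -> s <= t -> t <= ta -> `|gam s - x| <= c * bd_dist G (gam t)) ->
  bd_dist G x <= 4 * M -> (forall s, 0 <= s <= ta -> `|gam s - x| <= M) ->
  exists n v, [/\ is_chain G n v x (gam ta), chain_len v n <= 12 * N c * M &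
    forall i, (i <= n)%N -> chain_len v i <= (6 * N c * c * (N c + 1) + N c) * bd_dist G (v i)].
Proof.
move=> c1 ta01 cg g0 gG cn dM gM.
have Gx : G x by rewrite -g0; apply: gG; rewrite lexx ler01.
have dx := bd_dist_gt0 oG Gb Gx.
(* The dyadic radius exceeds [M] by at most the factor 2, which turns 6 into 12. *)
have [||i /andP[Mi iM]] := @doubling (bd_dist G x / 4) M; [by rewrite divr_gt0|by lra|].
have [||s [ps ls ns cs]] := half_chain c1 ta01 cg g0 gG cn (i := i) (t := ta).
- by case/andP: ta01 => -> _; rewrite lexx.
- by move=> s s01; apply: le_trans (gM s s01) Mi.
pose v j := nth (gam ta) (x :: s) j.
have lenv j : (j <= size s)%N -> chain_len v j = plen x (take j s).
  rewrite /v; elim: s x {ps ls ns cs v Gx dx g0 cn dM gM Mi iM} j => [|y s IH] x [|j] //=;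
    rewrite ?[chain_len _ 0]big_ord0//.
  by rewrite ltnS => js; rewrite /chain_len big_ord_recl /= -IH.
exists (size s), v; split.
- split => //; first by rewrite /v -last_nth ls.
  by move=> j js; have /(pathP (gam ta)) := ps => /(_ j js).
- rewrite lenv// take_size; apply: le_trans ns _.
  have : 0 <= 6 * N c by rewrite mulr_ge0// expR_ge0.
  by move/ler_wpM2l/(_ _ _ iM); lra.
- move=> j js; rewrite lenv//; have := cone_nth (gam ta) cs js; rewrite add0r; exact.
Qed.

End Natural.

(** * Length conditions in diameter uniform natural domains *)

Section LChain.
Context {R : realType} {E : normedModType R}.
Variables (G : set E).
Hypotheses (oG : open G) (Gb : bd G !=set0).
Implicit Types (x y z p q : E).

(** Both chains start at an endpoint, where their lengths are measured; the second is traversed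
    backwards, hence the index [n - i]. *)
Lemma lchain_join (K M : R) x y p q n1 v1 n2 v2 :
  is_chain G n1 v1 x p -> is_chain G n2 v2 y q -> step G p q ->
  chain_len v1 n1 + `|p - q| + chain_len v2 n2 <= M * `|x - y| -> M <= K ->
  (forall i, (i <= n1)%N -> chain_len v1 i <= K * bd_dist G (v1 i)) ->
  (forall i, (i <= n2)%N -> chain_len v2 i <= K * bd_dist G (v2 i)) ->
  lchain G K x y.
Proof.
move=> [v10 v1n st1] [v20 v2n st2] pq tot MK h1 h2.
pose n := (n1 + n2).+1.
pose v i := if (i <= n1)%N then v1 i else v2 (n - i)%N.
have n1n : (n1 < n)%N by rewrite ltnS leq_addr.
have vl i : (i <= n1)%N -> v i = v1 i by rewrite /v => ->.
have vr i : (i <= n2)%N -> v (n - i)%N = v2 i.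
  by move=> i2; rewrite /v ifF ?subKn//; rewrite /n; lia.
have lenl i : (i <= n1)%N -> chain_len v i = chain_len v1 i.
  move=> i1; apply: eq_bigr => k _; have k1 : (k.+1 <= n1)%N := leq_trans (ltn_ord k) i1.
  by rewrite !vl// ltnW.
have subS i : (i < n2)%N -> (n - i = (n - i.+1).+1)%N.
  by rewrite /n; lia.
have lenr i : (i <= n2)%N -> chain_len v n = chain_len v (n - i) + chain_len v2 i.
  elim: i => [|i IH] i2; first by rewrite subn0 /chain_len big_ord0 addr0.
  have e1 : chain_len v (n - i) = chain_len v (n - i.+1) + `|v (n - i)%N - v (n - i.+1)%N|.
    by rewrite (subS i i2) chain_lenS.
  have e2 := chain_lenS v2 i.
  rewrite (vr i (ltnW i2)) (vr i.+1 i2) distrC in e1.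
  by rewrite (IH (ltnW i2)) e1 e2 addrAC addrA.
have nn2 : (n - n2 = n1.+1)%N by rewrite /n; lia.
have lenn : chain_len v n = chain_len v1 n1 + `|p - q| + chain_len v2 n2.
  have vq : v n1.+1 = q by rewrite -nn2 (vr n2 (leqnn _)) v2n.
  by rewrite (lenr n2 (leqnn _)) nn2 chain_lenS (lenl n1 (leqnn _)) (vl n1 (leqnn _)) v1n vq
    (distrC q).
exists n, v; split.
- split.
  + by rewrite (vl 0%N (leq0n _)).
  + by have := vr 0%N (leq0n _); rewrite subn0 => ->.
  + move=> i ilt; have [i1|i1] := leqP i.+1 n1.
      by rewrite (vl i (ltnW i1)) (vl _ i1); exact: st1.
    have [e|ne] := eqVneq i n1.
      by rewrite e (vl n1 (leqnn _)) v1n -nn2 (vr n2 (leqnn _)) v2n.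
    have {ne}i1 : (n1 < i)%N by rewrite ltn_neqAle eq_sym ne -ltnS.
    have j2 : (n - i.+1 < n2)%N by rewrite /n in ilt *; lia.
    have e1 : i.+1 = (n - (n - i.+1))%N by rewrite /n in ilt *; lia.
    have e0 : i = (n - (n - i.+1).+1)%N by rewrite /n in ilt *; lia.
    have h0 := vr _ j2; have h0' := vr _ (ltnW j2); rewrite -e0 in h0; rewrite -e1 in h0'.
    by rewrite h0 h0' stepC; exact: st2.
- by rewrite lenn (le_trans tot)// ler_wpM2r.
- move=> i ilt; have [i1|i1] := leqP i n1; first by left; rewrite lenl// vl//; exact: h1.
  right; have j2 : (n - i <= n2)%N by rewrite /n; lia.
  have e0 : i = (n - (n - i))%N by rewrite subKn.
  have hv := vr _ j2; have hl := lenr _ j2; rewrite -e0 in hv hl.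
  by rewrite hl hv addrAC subrr add0r; exact: h2.
Qed.

(** Finds the step at which [P] is first lost. If it never is, the last point is paired with itself,
    which serves as a degenerate step. *)
Lemma last_before (P : R -> Prop) (e : rel R) a l : path e a l -> P a ->
  exists u v, [/\ P u, u \in a :: l, v \in a :: l &
    (u = last a l /\ v = u) \/ (e u v /\ ~ P v)].
Proof.
elim: l a => [|h t IH] a /=.
  by move=> _ Pa; exists a, a; split; rewrite ?mem_head//; left.
move=> /andP[ah pt] Pa; have [Ph|nPh] := pselect (P h); last first.
  by exists a, h; split; rewrite ?inE ?eqxx ?orbT//; right.
have [u [v [Pu uh vh H]]] := IH h pt Ph.
by exists u, v; split => //; rewrite inE ?uh ?vh orbT.
Qed.

Lemma diameter_dist (A : set E) z w (M : R) : A z -> A w ->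
  (diameter A <= M%:E)%E -> `|z - w| <= M.
Proof.
move=> Az Aw H; rewrite -lee_fin (le_trans _ H)//.
by apply: ereal_sup_ubound; exists (z, w).
Qed.

Lemma diameter_subset (A B : set E) : A `<=` B -> (diameter A <= diameter B)%E.
Proof.
move=> AB; apply: le_ereal_sup => _ [[p q] /= [Ap Aq] <-].
by exists (p, q) => //; split; exact: AB.
Qed.

(** The first summand is the main part of the cone constant of [half_chain]. The second covers its
    remaining n and the two half lengths, 24nc each; the third covers the step between the
    halves. *)
Definition natural_const (c : R) (psi : R -> R) : R :=
  let n := expR (psi (4 * c) + 1) in 6 * n * c * (n + 1) + 60 * n * c + 4 * c.

Lemma lchain_of_diameter_uniform (c : R) (psi : R -> R) x y :
  increasing_nneg psi -> natural_domain psi G -> diameter_uniform_domain c G ->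
  G x -> G y -> x != y -> lchain G (natural_const c psi) x y.
Proof.
move=> psi_inc nat_G [c1 du] Gx Gy xy.
have [gam [[cg g0 g1 gG] _] [tot loc]] := du x y Gx Gy xy.
move/within_cont_on in cg.
have {}gG u : 0 <= u <= 1 -> G (gam u).
  by move=> u01; apply: gG; exists u => //=; rewrite in_itv.
have tr a b u : a <= u <= b -> trace gam a b (gam u).
  by move=> ab; exists u => //=; rewrite in_itv.
have trS a b a' b' : a' <= a -> b <= b' -> trace gam a b `<=` trace gam a' b'.
  move=> aa bb _ [u + <-]; rewrite /= in_itv /= => /andP[au ub].
  by apply: tr; rewrite (le_trans aa au) (le_trans ub bb).
set r := `|x - y| in tot *.
have r0 : 0 < r by rewrite normr_gt0 subr_eq0.
have dist u v : 0 <= u <= 1 -> 0 <= v <= 1 -> `|gam u - gam v| <= c * r.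
  by move=> u01 v01; apply: diameter_dist tot; exact: tr.
have cr : r <= c * r by rewrite ler_peMl// ltW.
have dx := bd_dist_gt0 oG Gb Gx; have dy := bd_dist_gt0 oG Gb Gy.
have dlx := bd_dist_lip x y Gb; have dly := bd_dist_lip y x Gb.
rewrite (distrC y x) -/r in dly; rewrite -/r in dlx.
have psi0 : 0 <= psi (4 * c) by case: psi_inc => h _; apply: h; lra.
have n1 : 1 <= expR (psi (4 * c) + 1) by rewrite -[X in X <= _]expR0 ler_expR; lra.
rewrite /natural_const; set n := expR _ in n1 *; set K := _ + _ + _.
have nc : 1 <= n * c by rewrite -[1]mulr1 ler_pM.
have ncn : 1 <= n * c * (n + 1) by rewrite -[1]mulr1 ler_pM//; lra.
have nnc : n <= n * c by rewrite ler_peMr//; lra.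
have K1 : 6 * n * c * (n + 1) + n <= K by rewrite /K; lra.
have KM : 50 * (n * c) + 4 * c <= K by rewrite /K; lra.
have K0 : 4 <= K by lra.
have [close|far] := leP (4 * r) (bd_dist G x).
  apply: (@lchain_join K K x y x y 0%N (fun=> x) 0%N (fun=> y)) => //.
  - by apply/andP; rewrite -/r; split; lra.
  - by rewrite /chain_len !big_ord0 add0r addr0 -/r ler_peMl//; lra.
  - by case=> // _; rewrite /chain_len big_ord0 mulr_ge0//; lra.
  - by case=> // _; rewrite /chain_len big_ord0 mulr_ge0//; lra.
have [ts [pts lts sts]] := fine_chain oG Gb ler01 cg gG.
(* Initial diameters grow and final ones shrink with [t]. So the minimum in the diameter condition
   is on the side of x up to [ta] and on the side of y from [tb] on, and a single step joins these
   two times. *)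
pose P t := (diameter (trace gam 0 t) <= diameter (trace gam t 1))%E.
pose e := [rel u v : R | (u < v) && step G (gam u) (gam v)].
have pe : path e 0 ts by rewrite path_relI pts /=; move: sts; rewrite path_map.
have P0 : P 0.
  apply: (@le_trans _ _ 0%E).
    apply: (@le_trans _ _ (2 * 0)%:E); last by rewrite mulr0.
    apply: (@diameter_le _ _ _ (gam 0)) => _ [u + <-]; rewrite /= in_itv /= -eq_le => /eqP <-.
    by rewrite subrr normr0.
  apply: le_trans (_ : ((`|gam 0 - gam 0|)%:E <= _)%E); first by rewrite subrr normr0.
  by apply: ereal_sup_ubound; exists (gam 0, gam 0) => //=; split; apply: tr; rewrite lexx ler01.
have [ta [tb [Pa ina inb H]]] := last_before (P := P) pe P0.
have [_ bds] := path_lt_pairwise pts lts.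
have ta01 := bds ta ina; have tb01 := bds tb inb.
have stepab : step G (gam ta) (gam tb).
  case: H => [[_ ->]|[/andP[_ ->]//]].
  by rewrite /step subrr normr0 mulr0 !bd_dist_ge0.
have cx s t : 0 <= s -> s <= t -> t <= ta -> `|gam s - x| <= c * bd_dist G (gam t).
  move=> s0 st tta; have /andP[_ ta1] := ta01.
  have t01 : 0 <= t <= 1 by rewrite (le_trans s0 st) (le_trans tta ta1).
  have le1 : (diameter (trace gam 0 t) <= diameter (trace gam t 1))%E.
    apply: le_trans (diameter_subset (trS _ _ 0 ta _ tta)) _ => //.
    by apply: le_trans Pa _; apply: diameter_subset; exact: trS.
  have := loc t t01; rewrite (min_idPl le1); apply: diameter_dist; first by apply: tr; rewrite s0.
  by rewrite -g0; apply: tr; rewrite lexx; case/andP: t01.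
have cy s t : tb <= t -> t <= s -> s <= 1 -> `|gam s - y| <= c * bd_dist G (gam t).
  move=> tbt ts_ s1; have /andP[tb0 _] := tb01.
  have t01 : 0 <= t <= 1 by rewrite (le_trans tb0 tbt) (le_trans ts_ s1).
  case: H => [[ta_l tba]|[_ nP]].
    have t1 : t = 1 by rewrite tba ta_l lts in tbt; apply/eqP; rewrite eq_le tbt;
      case/andP: t01 => _ ->.
    have -> : s = 1 by apply/eqP; rewrite eq_le s1 -t1 ts_.
    by rewrite g1 subrr normr0 mulr_ge0 ?bd_dist_ge0//; lra.
  have le1 : (diameter (trace gam t 1) <= diameter (trace gam 0 t))%E.
    apply: le_trans (diameter_subset (trS _ _ tb 1 tbt _)) _ => //.
    apply: (@le_trans _ _ (diameter (trace gam 0 tb))).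
      by apply/ltW; rewrite ltNge; exact/negP.
    by apply: diameter_subset; exact: trS.
  have := loc t t01; rewrite (min_idPr le1); apply: diameter_dist.
    by apply: tr; rewrite ts_.
  by rewrite -g1; apply: tr; rewrite lexx; case/andP: t01 => _ ->.
have flip (t : R) : 0 <= t <= 1 -> 0 <= 1 - t <= 1.
  by move=> /andP[? ?]; rewrite subr_ge0 gerBl; apply/andP.
(* The radius is 2cr rather than cr because the boundary distance of y may come close to 5r and must
   not exceed 4M. *)
have [||k1 [v1 [ch1 L1 C1]]] := half_chain_fun (M := 2 * (c * r)) oG Gb psi_inc nat_G c1 ta01
  cg g0 gG cx.
- by lra.
- move=> s /andP[s0 sta]; have := dist s 0; rewrite g0; case/andP: ta01 => ta0 ta1.
  by rewrite s0 (le_trans sta ta1) lexx ler01 => /(_ isT isT); lra.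
pose gam' t := gam (1 - t).
have cg' : cont_on 0 1 gam'.
  apply: (@cont_on_comp_lip _ _ 0 1 0 1 gam (fun t => 1 - t) 1) => //.
  by move=> s t _ _; rewrite mul1r opprB addrC addrA subrK distrC.
have [|||||k2 [v2 [ch2 L2 C2]]] := half_chain_fun (gam := gam') (x := y) (M := 2 * (c * r))
  oG Gb psi_inc nat_G c1 (flip _ tb01) cg'.
- by rewrite /gam' subr0.
- by move=> u /flip/gG.
- move=> s t s0 st tt; apply: cy; first by rewrite lerBrDl -lerBrDr.
    by rewrite lerD2l lerN2.
  by rewrite gerBl.
- by lra.
- move=> s /andP[s0 stb]; have /andP[ftb0 ftb1] := flip _ tb01.
  have := dist (1 - s) 1 (flip s _); rewrite g1 lexx ler01 s0 (le_trans stb ftb1) => /(_ isT isT).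
  by rewrite /gam'; lra.
rewrite /gam' subKr in ch2.
apply: (lchain_join (M := K) ch1 ch2 stepab) => //.
- have := dist ta tb ta01 tb01; rewrite -/r.
  have : (50 * (n * c) + 4 * c) * r <= K * r by rewrite ler_pM2r.
  have L1' : chain_len v1 k1 <= 12 * n * (2 * (c * r)) := L1.
  have L2' : chain_len v2 k2 <= 12 * n * (2 * (c * r)) := L2.
  have : 0 < n * c * r by rewrite mulr_gt0//; lra.
  by move: L1' L2'; clear -r0 cr; lra.
- move=> i ik; apply: le_trans (C1 i ik) _; apply: ler_wpM2r; [exact: bd_dist_ge0|exact: K1].
- move=> i ik; apply: le_trans (C2 i ik) _; apply: ler_wpM2r; [exact: bd_dist_ge0|exact: K1].
Qed.

End LChain.

(** * The image path and the conclusion *)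

Section Image.
Context {R : realType}.

Lemma natural_const_ge1 (c : R) (psi : R -> R) : 1 <= c -> increasing_nneg psi ->
  1 <= natural_const c psi.
Proof.
move=> c1 [psi0 _]; rewrite /natural_const.
have := expR_ge0 (psi (4 * c) + 1); set n := expR _ => n0.
have h1 : 0 <= n * c by rewrite mulr_ge0//; lra.
have h2 : 0 <= n * c * (n + 1) by rewrite mulr_ge0//; lra.
lra.
Qed.

Lemma cont_on_comp {E E' : normedModType R} (A : set E) (f : E -> E') (g : R -> E) (a b : R) :
  {within A, continuous f} -> cont_on a b g -> (forall t, a <= t <= b -> A (g t)) ->
  cont_on a b (f \o g).
Proof.
move=> /subspace_continuousP cf cg gA t tab e e0.
have /cvgrPdist_lt/(_ e e0) := cf _ (gA t tab).
rewrite /within /= => /nbhs_ballP[d1 /= d10 H].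
have [del del0 Hg] := cg t tab d1 d10; exists del => // s sab st.
have := H (g s); rewrite -ball_normE /= distrC => /(_ (Hg s sab st) (gA s sab)).
by rewrite distrC.
Qed.

(** Finite by compactness of [0, L]. The maximum with 1 provides [1 <= H], which also covers
    degenerate quadruples. *)
Definition sup_on (eta : R -> R) (L : R) : R := Num.max 1 (sup (eta @` `[0, L])).

Lemma le_sup_on (eta : R -> R) (L : R) : {within [set s : R | 0 <= s], continuous eta} ->
  forall s, 0 <= s <= L -> eta s <= sup_on eta L.
Proof.
move=> ceta s s0L; have /andP[s0 sL] := s0L.
have L0 : 0 <= L := le_trans s0 sL.
have cL : {within `[0, L], continuous eta}.
  apply: continuous_subspaceW ceta => u; rewrite /= in_itv /=; by case/andP.
have [m _ mx] := EVT_max L0 cL.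
rewrite /sup_on le_max; apply/orP; right; apply: sup_upper_bound.
  split; first by exists (eta 0), 0 => //=; rewrite in_itv /= lexx.
  by exists (eta m) => _ [u + <-]; exact: mx.
by exists s => //=; rewrite in_itv.
Qed.

Lemma good_path_image {E E' : normedModType R} (c : R) (eta : R -> R) (G : set E) (G' : set E')
    (f : E -> E') : {within [set s : R | 0 <= s], continuous eta} ->
  domain G -> G != setT -> uniform_domain c G ->
  homeomorphism_on (closure G) (closure G') f ->
  quasimoebius_rel eta (Some @` closure G) (Some @` bd G) (omap f) -> f @` G = G' ->
  forall x y, G x -> G y -> x != y -> exists al,
    good_path G' (sup_on eta (32 * (c * c) * (c + 1))) (f x) (f y) al.
Proof.
move=> ceta dG GT [c1 unif] [bij cf _] qm fG x y Gx Gy xy.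
have Gb := bd_nonempty dG GT; have [_ oG _] := dG.
have [gam arc [tot loc]] := unif x y Gx Gy xy.
have [[cg g0 g1 gG] _] := arc.
have G01 t : 0 <= t <= 1 -> G (gam t).
  by move=> t01; apply: gG; exists t => //=; rewrite in_itv.
exists (f \o gam); split.
- apply: (cont_on_comp cf); first exact/within_cont_on.
  by move=> t /G01; exact: subset_closure.
- by rewrite /= g0.
- by rewrite /= g1.
- by move=> t /G01 Gt; rewrite -fG; exists (gam t).
- move=> s t s0 st t1.
  have Gs : G (gam s) by apply: G01; rewrite s0 (le_trans st).
  have Gt : G (gam t) by apply: G01; rewrite (le_trans s0).
  have H1 : 1 <= sup_on eta (32 * (c * c) * (c + 1)) by rewrite le_max lexx.
  have [h1 h2] := uniform_arc_cr_le oG Gb c1 arc tot loc s0 st t1.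
  by split; apply: (cr_le_transfer bij qm fG H1 (le_sup_on ceta)).
Qed.

End Image.

Theorem theorem1p3 (R : realType) :
  exists (c' : R -> (R -> R) -> R) (c1' : R -> (R -> R) -> (R -> R) -> R),
  forall (c : R) (eta : R -> R),
    1 <= c ->
    homeomorphism_on [set s : R | 0 <= s] [set s : R | 0 <= s] eta ->
  forall (E E' : completeNormedModType R) (G : set E) (G' : set E')
      (f : E -> E'),
    dim_ge2 E -> dim_ge2 E' ->
    domain G -> G != setT -> domain G' -> G' != setT ->
    uniform_domain c G ->
    homeomorphism_on (closure G) (closure G') f ->
    quasimoebius_rel eta (Some @` closure G) (Some @` bd G) (omap f) ->
    f @` G = G' ->
    diameter_uniform_domain (c' c eta) G' /\
    forall psi : R -> R,
      increasing_nneg psi -> natural_domain psi G' ->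
      uniform_domain (c1' c eta psi) G'.
Proof.
pose H c eta : R := sup_on eta (32 * (c * c) * (c + 1)).
pose C c eta : R := 60 * 32 * 32 * (H c eta * H c eta).
(* The factors 10 and 3 come from passing from chains to arcs; the naturality constant takes the
   diameter constant 10 C of the image as its input. *)
exists (fun c eta => 10 * C c eta), (fun c eta psi => 3 * natural_const (10 * C c eta) psi).
move=> c eta c1 [_ ceta _] E E' G G' f _ d2 dG GT dG' GT' unif hf qm fG.
have Gb' := bd_nonempty dG' GT'; have [_ oG' _] := dG'.
have H1 : 1 <= H c eta by rewrite /H /sup_on le_max lexx.
have [K KE] : exists K : R, K = C c eta by eexists.
have K1 : 1 <= K.
  have : 1 <= H c eta * H c eta by rewrite -[X in X <= _]mulr1 ler_pM.
  by rewrite KE /C; lra.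
have KH : 60 * 32 * 32 * (H c eta * H c eta) <= K by rewrite KE.
rewrite -KE; clear KE.
have du : diameter_uniform_domain (10 * K) G'.
  apply: (diameter_uniform_of_dchain oG' Gb' K1) => x' y'.
  rewrite -{1 2}fG => -[x Gx <-] [y Gy <-] xy'.
  have xy : x != y by apply: contraNneq xy' => ->.
  have [al gp] := good_path_image ceta dG GT unif hf qm fG Gx Gy xy.
  exact: (dchain_good_path d2 oG' Gb' H1 KH gp xy').
split => // psi psi_inc nat_G.
have K10 : 1 <= 10 * K by lra.
apply: (uniform_of_lchain oG' Gb' (natural_const_ge1 K10 psi_inc)) => x y Gx Gy xy.
exact: (lchain_of_diameter_uniform oG' Gb' psi_inc nat_G du Gx Gy xy).
Qed.
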